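(* Let $F/\mathbb{F}_q$ and $F'/\mathbb{F}_{q^t}$ be function fields such that $F'/F$ is a finite extension of degree $m\ge 2$. Let $\mathcal{C}=C_{\mathcal{L}}^F(D,G)$ be an AG-code over $F$ with $D=P_1+\cdots+P_n$, such that its conorm code $\mathcal{C}'=\mathrm{Con}_{F'/F}(\mathcal{C})=C_{\mathcal{L}}^{F'}(D',G')$ is defined, and let $n'$ and $d'$ be the length and minimum distance of $\mathcal{C}'$. Let $s$ (resp. $r$) be the number of places $P_i$ in $D$ which split completely (resp. are totally ramified) in $F'$, and assume that $n=r+s$. Then: (a) the length $n'$ satisfies $$n+s\le n'=ms+r\le mn-r,$$ and equalities hold (that is, both inequalities are equalities) if and only if the extension $F'/F$ is quadratic ($m=2$). (b) $n'=mn$ if and only if $s=n$ and $r=0$; and in this case $d'\ge m\left(n-\tfrac{\deg G}{t}\right)$. (c) $n'=n$ if and only if $s=0$ and $r=n$; and in this case $d'\ge n-\tfrac{m}{t}\deg G=n-\deg G'$.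
   Context: A function field $F/\mathbb{F}_q$ is a finite extension of a rational function field $\mathbb{F}_q(x)$ with $\mathbb{F}_q$ algebraically closed in $F$ (full constant field); likewise $\mathbb{F}_{q^t}$ is the full constant field of $F'$. A rational place is a place of degree one; $e(P'|P)$ is the ramification index. A place $P$ of $F$ splits completely in $F'$ if there are $m=[F':F]$ distinct places of $F'$ above it, and is totally ramified if there is a place $P'$ above it with $e(P'|P)=m$. For a divisor $G$ of $F$, $\mathcal{L}(G)=\{z\in F^*:(z)\ge -G\}\cup\{0\}$. AG-codes: if $D=P_1+\cdots+P_n$ is a sum of $n$ distinct rational places of $F$ and $G$ is a divisor of $F$ with support disjoint from that of $D$, then $C_{\mathcal{L}}^F(D,G)=\{(z(P_1),\ldots,z(P_n)):z\in\mathcal{L}(G)\}\subseteq\mathbb{F}_q^n$, where $z(P_i)$ is the residue class of $z$ modulo $P_i$. Conorm of divisors: $\mathrm{Con}_{F'/F}(P)=\sum_{P'|P}e(P'|P)P'$ for a place $P$ of $F$, extended linearly to all divisors. Conorm code: for a place $P$ of $F$ let $m_P$ be the number of places of $F'$ above $P$. The conorm code is defined under the standing condition that for every $P$ in the support of $D$ one has $e(P'|P)=m/m_P$ for all places $P'$ of $F'$ above $P$; all the places above the $P_i$ are then rational. It is the AG-code $\mathrm{Con}_{F'/F}(\mathcal{C})=C_{\mathcal{L}}^{F'}(D',G')$, where $D'$ is the sum of all places of $F'$ lying above $P_1,\ldots,P_n$ (each with coefficient 1) and $G'=\mathrm{Con}_{F'/F}(G)$. *)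

(* Defs.v *)
From HB Require Import structures.
From mathcomp Require Import all_boot all_order all_algebra fieldext.
From mathcomp Require Import finmap.
From mathcomp Require Import boolp classical_sets functions cardinality fsbigop.
From mathcomp Require Import freeg.

Set Implicit Arguments.
Unset Strict Implicit.
Unset Printing Implicit Defensive.

Import Order.TTheory GRing.Theory Num.Theory.
Local Open Scope ring_scope.

(* A field F containing k is given by the embedding iota : k -> F. *)
Section FunctionFields.
Variables (k : finFieldType) (F : fieldType) (iota : {rmorphism k -> F}).

(* Up to k-isomorphism, F is a finite extension L of the field k(x) of
   rational functions, and k is algebraically closed in F. *)
Definition function_field : Prop :=
  (exists (L : fieldExtType {fraction {poly k}}) (phi : {rmorphism L -> F}),
      bijective phi
      /\ forall c : k, phi (FracField.tofrac c%:P)%:A = iota c)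
  /\ (forall z : F, algebraicOver iota z -> exists c : k, z = iota c).

(* Valuation rings of F/k: rings k < O < F (strict inclusions) that contain
   z or z^-1 for every z. *)
Definition valuation_ring (O : {pred F}) : Prop :=
  [/\ subring_closed O,
      forall c : k, iota c \in O,
      exists2 z : F, z \in O & forall c : k, z != iota c,
      exists z : F, z \notin O
    & forall z : F, (z \in O) || (z^-1 \in O)].

(* A place is represented by its valuation ring; the place proper is
   [maxideal] below, the maximal ideal of that ring, and the two determine
   each other. *)
Record place := Place {
  vring :> {pred F};
  vringP : valuation_ring vring
}.

HB.instance Definition _ := gen_eqMixin place.
HB.instance Definition _ := gen_choiceMixin place.

Definition vunit (P : place) : {pred F} :=
  [pred z | [&& z != 0, z \in vring P & z^-1 \in vring P]].

Definition maxideal (P : place) : {pred F} :=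
  [pred z | (z \in vring P) && (z \notin vunit P)].

Definition prime_element (P : place) (pi : F) : Prop :=
  forall z : F, z \in maxideal P <-> exists2 w, w \in vring P & z = pi * w.

(* v_P(z) for z != 0; the value at 0 is irrelevant. *)
Definition valuation (P : place) (z : F) : int :=
  xget 0 [set n : int | exists pi u : F,
    [/\ prime_element P pi, u \in vunit P & z = pi ^ n * u]]%classic.

(* The residues of u_0, ..., u_(d-1) form a k-basis of O_P / P. *)
Definition residue_basis (P : place) (d : nat) (u : 'I_d -> F) : Prop :=
  (forall i, u i \in vring P)
  /\ (forall z : F, z \in vring P ->
        exists! c : 'rV[k]_d,
          z - \sum_(i < d) iota (c 0 i) * u i \in maxideal P).

(* The k-dimension of O_P / P, always finite in a function field, so that the
   default value 0 is never reached there. *)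
Definition place_degree (P : place) : nat :=
  xget 0%N [set d : nat | exists u : 'I_d -> F, residue_basis P u]%classic.

Definition rational_place (P : place) : bool := place_degree P == 1%N.

(* z(P) for a rational place P, with O_P / P identified with k. *)
Definition residue (P : place) (z : F) : k :=
  xget 0 [set c : k | z - iota c \in maxideal P]%classic.

Definition divisor := {freeg place / int}.

Definition divisor_degree (G : divisor) : int :=
  \sum_(P <- dom G) coeff P G * (place_degree P)%:Z.

Definition RiemannRoch_space (G : divisor) : set F :=
  [set z : F | z = 0 \/
     (z != 0 /\ forall P : place, - coeff P G <= valuation P z)]%classic.

(* The divisor D = P_1 + ... + P_n is given by the sequence of the P_i. *)
Definition AG_code_defined (D : seq place) (G : divisor) : Prop :=
  [/\ uniq D, all rational_place D
    & forall P : place, P \in D -> coeff P G = 0].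

Definition AG_code (D : seq place) (G : divisor) : set 'rV[k]_(size D) :=
  [set \row_i residue (tnth (in_tuple D) i) z | z in RiemannRoch_space G]%classic.

End FunctionFields.

Arguments AG_code {k F iota} D G.

Definition hamming_distance (k : finFieldType) (n : nat) (x y : 'rV[k]_n) : nat :=
  #|[set i : 'I_n | x 0 i != y 0 i]|.

(* A code with fewer than two words has no minimum distance. *)
Definition is_minimum_distance (k : finFieldType) (n : nat)
    (C : set 'rV[k]_n) (d : nat) : Prop :=
  (exists x y, [/\ C x, C y, x <> y & hamming_distance x y = d])
  /\ (forall x y, C x -> C y -> x <> y -> (d <= hamming_distance x y)%N).

Section Extensions.
Variables (k k' : finFieldType) (F : fieldType) (F' : fieldExtType F).
Variables (iota : {rmorphism k -> F}) (iota' : {rmorphism k' -> F'}).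

Definition lies_over (P' : place iota') (P : place iota) : Prop :=
  forall z : F, z \in maxideal P -> z%:A \in maxideal P'.

Definition ramification_index (P' : place iota') (P : place iota) : nat :=
  xget 0%N [set e : nat | forall z : F, z != 0 ->
    valuation P' z%:A = e%:Z * valuation P z]%classic.

Definition places_above (P : place iota) : set (place iota') :=
  [set P' | lies_over P' P]%classic.

(* [fset_set] (here and below) is empty and the sum over [places_above P] is 0
   for infinite sets, but only finitely many places lie above P. *)
Definition nb_places_above (P : place iota) : nat :=
  #|` fset_set (places_above P) |.

Definition splits_completely (P : place iota) : bool :=
  nb_places_above P == \dim {:F'}.

Definition totally_ramified (P : place iota) : bool :=
  `[< exists2 P' : place iota', lies_over P' P
        & ramification_index P' P = \dim {:F'} >].

Definition conorm (G : divisor iota) : divisor iota' :=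
  \sum_(P <- dom G) coeff P G *:
    (\sum_(P' \in places_above P) << (ramification_index P' P)%:Z *g P' >>).

(* The places of the divisor D', in an arbitrary order. *)
Definition conorm_places (D : seq (place iota)) : seq (place iota') :=
  enum_fset (fset_set
    [set P' | exists2 P, P \in D & lies_over P' P]%classic).

(* e(P'|P) = m / m_P, without the division. *)
Definition conorm_code_defined (D : seq (place iota)) : Prop :=
  forall (P : place iota) (P' : place iota'), P \in D -> lies_over P' P ->
    (ramification_index P' P * nb_places_above P)%N = \dim {:F'}.

Definition conorm_code (D : seq (place iota)) (G : divisor iota) :
    set 'rV[k']_(size (conorm_places D)) :=
  AG_code (conorm_places D) (conorm G).

End Extensions.

Arguments splits_completely {k k' F F' iota} iota' P.
Arguments totally_ramified {k k' F F' iota} iota' P.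
Arguments conorm {k k' F F' iota} iota' G.
Arguments conorm_places {k k' F F' iota} iota' D.
Arguments conorm_code_defined {k k' F F' iota} iota' D.
Arguments conorm_code {k k' F F' iota} iota' D G.

(* Main.v *)
From HB Require Import structures.
Require Import Defs.
From mathcomp Require Import all_boot all_order all_algebra falgebra fieldext.
From mathcomp Require Import finmap zify.
From mathcomp Require Import boolp classical_sets functions cardinality fsbigop.
From mathcomp Require Import freeg.

(* Degrees are counted through linear independence over a polynomial ring k[x].
   If P runs over zeros of x, weak approximation lifts
   bases of the rings O_P / x O_P to a family independent over k[x] of size
   sum v_P(x) deg P. Conversely a family of N elements independent over k[x]
   yields N (J + 1) combinations x^j u_i; if N exceeded the degree of the poles
   of x, a nonzero combination would vanish at all these poles and have no pole
   elsewhere, hence be a constant equal to 0. Thus deg (x)_0 = deg (x)_oo, which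
   gives the bound d >= n - deg G for AG codes.

   For F'/F, with Q over P, counting the ring of elements integral at all the Q
   modulo a uniformizer of P gives sum e(Q|P) deg Q <= m deg P when the constant
   fields agree; comparing the degrees of the zeros of x in F and F' turns this
   into an equality, so deg Con(G) = m deg G. The constant fields do agree: at
   P = P_1 the condition e(Q|P) m_P = m already exhausts the inequality, which
   forces all residue fields over P to be k, so that t = 1. *)

Set Implicit Arguments.
Unset Strict Implicit.
Unset Printing Implicit Defensive.

Import Order.TTheory GRing.Theory Num.Theory.
Local Open Scope classical_set_scope.
Local Open Scope ring_scope.

(** Places are bare valuation rings here, so discreteness of valuations, finiteness of residue
    degrees and finiteness of the set of zeros of a function all have to be derived. Each comes from
    one crude fact: for fixed x, families independent over k[x] have bounded size. The sharp value
    is found later by comparing x with 1/x, without computing [F : k(x)]. As k is finite, dimension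
    counts become cardinality counts: a linear map with more unknowns than equations is a
    non-injective map of finite sets, and the difference of two colliding arguments is the relation
    sought. That a function without poles is constant requires enough places. They come from
    Chevalley's argument: a maximal ring containing k[1/z] in which 1/z is not invertible is a
    valuation ring. The hypothesis n > 0 matters: the place P_1 is what ties the constants of F' to
    those of F. *)

Lemma finite_pigeonhole (A B : finType) (f : A -> B) :
  (#|B| < #|A|)%N -> exists x y, x <> y /\ f x = f y.
Proof.
move=> ltBA; apply/not_existsP => nf.
have /leq_card : injective f.
  by move=> x y eqf; apply: contrapT => neq; apply: (nf x); exists y.
by rewrite leqNgt ltBA.
Qed.

Lemma common_denominator (R : idomainType) (I : finType)
    (a : I -> {fraction R}) :
  exists2 h : R, h != 0 & exists b : I -> R,
    forall i, FracField.tofrac h * a i = FracField.tofrac (b i).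
Proof.
have frac1 (z : {fraction R}) : exists nd : R * R,
    nd.2 != 0 /\ FracField.tofrac nd.2 * z = FracField.tofrac nd.1.
  elim/quotW: z => x; exists (frac x); split; first exact: denom_ratioP.
  unlock FracField.tofrac; rewrite -[LHS]FracField.pi_mul; apply/eqmodP.
  rewrite /= FracField.equivfE /FracField.mulf.
  by rewrite !numden_Ratio ?(mul1r, mulr1, oner_neq0, denom_ratioP) // mulrC.
have {frac1} [nd ndP] := choice frac1.
exists (\prod_i (nd (a i)).2).
  by apply/prodf_neq0 => i _; case: (ndP (a i)).
exists (fun i => (nd (a i)).1 * \prod_(j | j != i) (nd (a j)).2) => i.
rewrite (bigD1 i) //= !rmorphM /= -(ndP (a i)).2.
by rewrite mulrAC.
Qed.

(** * Linear independence over k[x] *)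

Section FunctionField.
Variables (k : finFieldType) (F : fieldType) (iota : {rmorphism k -> F}).

(** For transcendental x, clearing denominators makes this independence over k(x). For a constant x
    only the empty family qualifies, since a nonzero polynomial vanishes at x. *)
Definition kx_free (x : F) (I : finType) (u : I -> F) : Prop :=
  forall p : I -> {poly k},
    \sum_i (map_poly iota (p i)).[x] * u i = 0 -> forall i, p i = 0.

(* Degree count: over k(x_0) the coordinates of the products x^j u_i (j <= J),
   brought to a common denominator, have degree at most J delta + O(1), where
   delta depends on x only. *)
Lemma kx_free_bounded : function_field iota -> forall x : F,
  exists B, forall (I : finType) (u : I -> F), kx_free x u -> (#|I| <= B)%N.
Proof.
case=> -[L [phi [phi_bij phi_k]] _ x].
have [psi phiK psiK] := phi_bij.
pose d := \dim {:L}; pose b := vbasis {:L}.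
pose co (z : L) (a : 'I_d) := coord b a z.
have co_eq z : z = \sum_a co z a *: b`_a by apply: coord_vbasis; rewrite memvf.
pose x0 := psi x.
have [h h0 [A hA]] := common_denominator
  (fun ab : 'I_d * 'I_d => co (x0 * b`_ab.1) ab.2).
have co_x z c : co (x0 * z) c = \sum_a co z a * co (x0 * b`_a) c.
  rewrite {1}(co_eq z) mulr_sumr /co linear_sum /=; apply: eq_bigr => a _.
  by rewrite -scalerAr linearZ.
have [delta hdelta] : exists D, (size h <= D.+1)%N /\
    forall ab, (size (A ab) <= D.+1)%N.
  exists (size h + \max_ab size (A ab))%N; split; first by lia.
  move=> ab; rewrite ltnW // ltnS (leq_trans _ (leq_addl _ _)) //.
  exact: (leq_bigmax (F := fun ab => size (A ab))).
case: hdelta => hh hAs.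
exists (d * delta)%N => I u ufree.
rewrite leqNgt; apply/negP => ltB.
have [g g0 [V hV]] := common_denominator
  (fun ia : I * 'I_d => co (psi (u ia.1)) ia.2).
pose c := \max_ia size (V ia).
have pow i j : exists W : 'I_d -> {poly k}, forall a,
    (size (W a) <= j * delta + c.+1)%N /\
    FracField.tofrac (h ^+ j * g) * co (x0 ^+ j * psi (u i)) a
      = FracField.tofrac (W a).
  elim: j => [|j [W hW]].
    exists (fun a => V (i, a)) => a; rewrite expr0 !mul1r (hV (i, a));
      split=> //.
    by rewrite ltnW // ltnS (leq_bigmax (F := fun ia => size (V ia)) (i, a)).
  exists (fun a => \sum_e W e * A (e, a)) => a; split.
    apply: (leq_trans (size_sum _ _ _)); apply/bigmax_leqP => e _.
    apply: (leq_trans (size_polyMleq _ _)).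
    have := (hW e).1; have := hAs (e, a); rewrite mulSn;
      move: (j * _)%N (size (W e)) (size (A _)) => *; lia.
  rewrite !exprS -!mulrA co_x mulr_sumr rmorph_sum.
  apply: eq_bigr => e _; rewrite [in RHS]rmorphM /= -(hW e).2 -(hA (e, a)) /=.
  by rewrite [in LHS]rmorphM /= [X in X * _]mulrC mulrACA.
(* All products are put over the denominator [h ^+ J * g], with numerators of size at most T. There
   are d * T = d * delta * J + J coefficients to match, fewer than the #|I| * (J + 1) unknowns once
   #|I| > d * delta; J = d * (c + 1) is chosen for this. *)
pose J := (d * c.+1)%N; pose T := (J * delta + c.+1)%N.
have powJ i (j : 'I_J.+1) : exists W : 'I_d -> {poly k}, forall a,
    (size (W a) <= T)%N /\
    FracField.tofrac (h ^+ J * g) * co (x0 ^+ j * psi (u i)) a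
      = FracField.tofrac (W a).
  have [W hW] := pow i j.
  have jJ : (j <= J)%N by rewrite -ltnS.
  exists (fun a => h ^+ (J - j) * W a) => a; split.
    apply: (leq_trans (size_polyMleq _ _)).
    have := (hW a).1; have := size_poly_exp_leq h (J - j).
    have : ((size h).-1 * (J - j) <= delta * (J - j))%N.
      by rewrite leq_mul2r; apply/orP; right; lia.
    have -> : T = (delta * (J - j) + (j * delta + c.+1))%N.
      by rewrite addnA [(delta * _)%N]mulnC -mulnDl subnK.
    move: (j * _)%N (_ * (J - j))%N (_ * (J - j))%N (size (h ^+ _)) (size (W a)).
    by move=> *; lia.
  rewrite -{1}(subnK jJ) exprD -mulrA [in RHS]rmorphM /= -(hW a).2.
  by rewrite [in LHS]rmorphM /= mulrA.
have {powJ} [W hW] : exists W : I -> 'I_J.+1 -> 'I_d -> {poly k},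
    forall i j a,
    (size (W i j a) <= T)%N /\
    FracField.tofrac (h ^+ J * g) * co (x0 ^+ j * psi (u i)) a
      = FracField.tofrac (W i j a).
  exists (fun i => projT1 (choice (powJ i))) => i.
  exact: projT2 (choice (powJ i)).
have WT i j a : (size (W i j a) <= T)%N by case: (hW i j a).
have WE i j a := (hW i j a).2.
pose Wc (cf : {ffun I * 'I_J.+1 -> k}) a : {poly k} :=
  \sum_i \sum_j cf (i, j) *: W i j a.
have Wc_size cf a : (size (Wc cf a) <= T)%N.
  apply: (leq_trans (size_sum _ _ _)); apply/bigmax_leqP => i _.
  apply: (leq_trans (size_sum _ _ _)); apply/bigmax_leqP => j _.
  exact: leq_trans (size_scale_leq _ _) (WT i j a).
have [cf [cf' [neq_cf eq_cf]]] :
    exists cf cf' : {ffun I * 'I_J.+1 -> k},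
      cf <> cf' /\ [ffun al : 'I_d * 'I_T => (Wc cf al.1)`_al.2]
                  = [ffun al : 'I_d * 'I_T => (Wc cf' al.1)`_al.2].
  apply: finite_pigeonhole; rewrite !card_ffun !card_prod !card_ord.
  rewrite ltn_exp2l; last exact: card_finRing_gt1.
  suff arith D E C N : (D * E < N ->
      D * (D * C.+1 * E + C.+1) < N * (D * C.+1).+1)%N by exact: arith.
  move=> DE; apply: (@leq_trans ((D * E).+1 * (D * C.+1).+1)); last first.
    by rewrite leq_mul2r DE orbT.
  by rewrite mulnDr !mulnS !mulSn; nia.
have {}eq_cf a : Wc cf a = Wc cf' a.
  apply/polyP => l; have [lT|Tl] := ltnP l T; last first.
    by rewrite !nth_default // (leq_trans (Wc_size _ _)).
  by have /ffunP/(_ (a, Ordinal lT)) := eq_cf; rewrite !ffunE.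
pose e i j := cf (i, j) - cf' (i, j).
pose p i := \sum_(j < J.+1) e i j *: 'X^j.
have pE i : (map_poly iota (p i)).[x] = \sum_(j < J.+1) iota (e i j) * x ^+ j.
  rewrite rmorph_sum horner_sum; apply: eq_bigr => j _ /=.
  by rewrite map_polyZ map_polyXn hornerZ hornerXn.
have p0 : forall i, p i = 0.
  apply: ufree.
  pose z := \sum_i \sum_(j < J.+1)
    FracField.tofrac (e i j)%:P *: (x0 ^+ j * psi (u i)).
  suff z0 : z = 0.
    rewrite -[RHS](rmorph0 phi) -z0 rmorph_sum; apply: eq_bigr => i _.
    rewrite pE mulr_suml rmorph_sum; apply: eq_bigr => j _ /=.
    by rewrite -mulr_algl !rmorphM rmorphXn /= phi_k !psiK mulrA.
  rewrite (co_eq z) big1 // => a _; suff -> : co z a = 0 by rewrite scale0r.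
  apply/eqP; rewrite -(mulrI_eq0 _ (mulfI _ : GRing.lreg (FracField.tofrac (h ^+ J * g)))).
    rewrite /co linear_sum mulr_sumr.
    rewrite (_ : \sum_i _ = FracField.tofrac (Wc cf a - Wc cf' a)).
      by rewrite eq_cf subrr rmorph0.
    rewrite -sumrB rmorph_sum; apply: eq_bigr => i _ /=.
    rewrite -sumrB rmorph_sum linear_sum mulr_sumr; apply: eq_bigr => j _ /=.
    by rewrite linearZ /= mulrCA WE -scalerBl -mul_polyC rmorphM.
  by rewrite tofrac_eq0 mulf_neq0 ?expf_neq0.
apply: neq_cf; apply/ffunP => -[i j]; apply/eqP; rewrite -subr_eq0.
have /polyP/(_ j) := p0 i; rewrite coef0 coef_sumMXn => /eqP.
by rewrite (big_pred1 j).
Qed.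
End FunctionField.

(** * Valuation rings and discreteness *)

Section ValuationRing.
Variables (k : finFieldType) (F : fieldType) (iota : {rmorphism k -> F}).
Implicit Types (P : place iota) (x y z w : F).

Lemma vring_subring P : subring_closed (vring P).
Proof. by case: (vringP P). Qed.

HB.instance Definition _ P :=
  GRing.isSubringClosed.Build F (vring P) (vring_subring P).

Lemma vring_const P c : iota c \in vring P.
Proof. by case: (vringP P) => _ /(_ c). Qed.

Lemma vring_total P z : z \notin vring P -> z^-1 \in vring P.
Proof. by case: (vringP P) => _ _ _ _ /(_ z); case: (z \in vring P). Qed.

Lemma vunitE P z :
  (z \in vunit P) = [&& z != 0, z \in vring P & z^-1 \in vring P].
Proof. by []. Qed.

Lemma maxidealE P z : (z \in maxideal P) = (z == 0) || (z^-1 \notin vring P).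
Proof.
rewrite inE /= vunitE; have [->|z0] /= := eqVneq; first by rewrite rpred0.
have [zO|/vring_total->//] := boolP (z \in vring P).
by [].
Qed.

Lemma maxideal_vring P z : z \in maxideal P -> z \in vring P.
Proof. by rewrite inE => /andP[]. Qed.

Lemma maxideal0 P : 0 \in maxideal P.
Proof. by rewrite maxidealE eqxx. Qed.

Lemma maxidealMl P z w : z \in vring P -> w \in maxideal P ->
  z * w \in maxideal P.
Proof.
rewrite !maxidealE mulf_eq0; have [//|z0] := eqVneq z 0.
have [//|w0] /= := eqVneq w 0 => zO; apply: contra.
by rewrite invfM => /(rpredM zO); rewrite mulVKf.
Qed.

Lemma maxidealMr P z w : z \in maxideal P -> w \in vring P ->
  z * w \in maxideal P.
Proof. by move=> *; rewrite mulrC maxidealMl. Qed.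

Lemma maxidealN P z : (- z \in maxideal P) = (z \in maxideal P).
Proof. by rewrite !maxidealE oppr_eq0 invrN rpredN. Qed.

(** One of z / w and w / z is in the ring, so z + w is a multiple of w or of z. *)
Lemma maxidealD P z w : z \in maxideal P -> w \in maxideal P ->
  z + w \in maxideal P.
Proof.
have [->|z0] := eqVneq z 0; first by rewrite add0r.
have [->|w0] := eqVneq w 0; first by rewrite addr0.
move=> zm wm; have [zwO|/vring_total] := boolP (z / w \in vring P).
  by rewrite -(divfK w0 z) -{3}[w]mul1r -mulrDl maxidealMl ?rpredD ?rpred1.
rewrite invf_div => wzO.
by rewrite -(divfK z0 w) -{1}[z]mul1r -mulrDl maxidealMl ?rpredD ?rpred1.
Qed.

Lemma maxidealB P z w : z \in maxideal P -> w \in maxideal P ->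
  z - w \in maxideal P.
Proof. by move=> zm wm; rewrite maxidealD // maxidealN. Qed.

Lemma maxideal_sum P (I : Type) (r : seq I) (C : pred I) (f : I -> F) :
  (forall i, C i -> f i \in maxideal P) ->
  \sum_(i <- r | C i) f i \in maxideal P.
Proof.
move=> fm; elim/big_ind: _ => // [|z w]; [exact: maxideal0|exact: maxidealD].
Qed.

Lemma maxideal1 P : 1 \in maxideal P = false.
Proof. by rewrite maxidealE oner_eq0 invr1 rpred1. Qed.

Lemma vunit_maxideal P z : z \in vring P ->
  (z \in vunit P) = (z \notin maxideal P).
Proof. by rewrite [_ \in maxideal _]inE => -> /=; rewrite negbK. Qed.

Lemma maxidealV P z : z != 0 -> (z \notin vring P) = (z^-1 \in maxideal P).
Proof. by move=> z0; rewrite maxidealE invr_eq0 (negPf z0) invrK. Qed.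

Lemma maxideal_const P c : (iota c \in maxideal P) = (c == 0).
Proof. by rewrite maxidealE fmorph_eq0 -fmorphV vring_const orbF. Qed.

Lemma vunitM P z w : z \in vunit P -> w \in vunit P -> z * w \in vunit P.
Proof.
rewrite !vunitE => /and3P[z0 zO zVO] /and3P[w0 wO wVO].
by rewrite mulf_neq0 // invfM !rpredM.
Qed.

Lemma vunitV P z : (z^-1 \in vunit P) = (z \in vunit P).
Proof. by rewrite !vunitE invr_eq0 invrK [X in _ && X]andbC. Qed.

Lemma vunit1 P : 1 \in vunit P.
Proof. by rewrite vunitE oner_neq0 invr1 rpred1. Qed.

Lemma vunitX P z (n : int) : z \in vunit P -> z ^ n \in vunit P.
Proof.
move=> zu; have Xn m : z ^+ m \in vunit P.
  by elim: m => [|m IHm]; rewrite ?expr0 ?vunit1 // exprS vunitM.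
by case: n => m; rewrite ?NegzE ?exprnN -?exprnP ?vunitV.
Qed.

Lemma vring_horner P (p : {poly k}) x : x \in vring P ->
  (map_poly iota p).[x] \in vring P.
Proof.
move=> xO; rewrite horner_coef rpred_sum // => i _.
by rewrite coef_map rpredM ?rpredX ?vring_const.
Qed.

Lemma place_inj P P' : vring P =i vring P' -> P = P'.
Proof.
case: P P' => [O hO] [O' hO'] /= eqO.
have {}eqO : O = O' by apply/funext => z; exact: eqO.
by case: _ / eqO in hO' *; congr Place; apply: Prop_irrelevance.
Qed.

(* Dividing a relation by x as long as possible leaves one whose constant terms
   do not all vanish. *)
Lemma kx_free_criterion x (I : finType) (u : I -> F) : x != 0 ->
  (forall (c : I -> k) (r : I -> {poly k}),
    \sum_i (iota (c i) + x * (map_poly iota (r i)).[x]) * u i = 0 ->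
    forall i, c i = 0) ->
  kx_free iota x u.
Proof.
move=> x0 crit p; have [N] : exists N, forall i, (size (p i) <= N)%N.
  by exists (\max_i size (p i)) => i; apply: leq_bigmax.
elim: N p => [|N IHN] p hN sum0.
  by move=> i; apply/eqP; rewrite -size_poly_eq0 -leqn0.
pose c i := (p i)`_0; pose r i := drop_poly 1 (p i).
have pE i : p i = (c i)%:P + 'X * r i.
  rewrite mulrC -[LHS](poly_take_drop 1) expr1; congr (_ + _).
  by apply/polyP => j; rewrite coef_take_poly coefC; case: j.
have pxE i : (map_poly iota (p i)).[x]
    = iota (c i) + x * (map_poly iota (r i)).[x].
  by rewrite pE rmorphD rmorphM /= map_polyC map_polyX !hornerE.
have c0 : forall i, c i = 0.
  by apply: (crit c r); rewrite -[RHS]sum0; apply: eq_bigr => i _; rewrite pxE.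
have r0 : forall i, r i = 0.
  apply: IHN => [i|]; first by rewrite size_drop_poly leq_subLR add1n.
  apply: (mulfI x0); rewrite mulr0 -[RHS]sum0 mulr_sumr.
  by apply: eq_bigr => i _; rewrite pxE c0 rmorph0 add0r mulrA.
by move=> i; rewrite pE c0 r0 mulr0 addr0.
Qed.

(** The y i have strictly decreasing positive orders, at most that of x. In a relation, take the
    last j with nonzero constant term c j and divide by y j. Terms before j fall into the maximal
    ideal; so do all terms carrying a factor x, because x / y j is integral and y i lies in the
    ideal. Hence c j would lie there too. *)
Lemma kx_free_chain P x n (y : nat -> F) :
  x \in maxideal P -> x != 0 ->
  (forall i, (i < n)%N -> y i \in maxideal P /\ y i != 0) ->
  (forall i, (i < n)%N -> x / y i \in vring P) ->
  (forall i j, (i < j)%N -> (j < n)%N -> y i / y j \in maxideal P) ->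
  kx_free iota x (fun i : 'I_n => y i).
Proof.
move=> xm x0 ym xy yy; apply: kx_free_criterion => // c r sum0.
move=> i0; apply/eqP/contraT => ci0.
case: (arg_maxnP (P := fun i => c i != 0) (fun i : 'I_n => i : nat) ci0) => j cj jmax.
suff : iota (c j) \in maxideal P by rewrite maxideal_const (negPf cj).
have yj0 := (ym j (ltn_ord j)).2.
have rO i := vring_horner (r i) (maxideal_vring xm).
suff -> : iota (c j) = - (x * (map_poly iota (r j)).[x] +
   \sum_(i | i != j) (iota (c i) + x * (map_poly iota (r i)).[x]) * (y i / y j)).
  rewrite maxidealN maxidealD ?maxidealMr // maxideal_sum // => i ij.
  have [lt_ij|le_ji] := ltnP i j.
    by rewrite maxidealMl ?yy // rpredD ?vring_const ?rpredM // maxideal_vring.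
  have -> : c i = 0.
    apply: contra_neq_eq ij => ci; apply/val_inj/eqP.
    by rewrite eqn_leq le_ji andbT; exact: jmax.
  rewrite rmorph0 add0r.
  rewrite [X in X \in _](_ : _ = (x / y j * (map_poly iota (r i)).[x]) * y i).
    by apply: maxidealMl;
      [apply: rpredM; [exact: xy|]|case: (ym i (ltn_ord i))].
  by rewrite -!mulrA; congr (_ * _); rewrite [RHS]mulrC mulrA.
apply/eqP; rewrite -addr_eq0 addrA; apply/eqP/(mulIf yj0).
rewrite mul0r -[RHS]sum0 [in RHS](bigD1 j) //= mulrDl; congr (_ + _).
by rewrite mulr_suml; apply: eq_bigr => i _; rewrite -mulrA divfK.
Qed.
End ValuationRing.

(** * The discrete valuation attached to a place *)

Section Valuation.
Variables (k : finFieldType) (F : fieldType) (iota : {rmorphism k -> F}).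
Hypothesis hF : function_field iota.
Implicit Types (P : place iota) (x y z w t : F).

Lemma maxideal_neq0 P : exists2 x, x \in maxideal P & x != 0.
Proof.
case: (vringP P) => _ _ _ [z zO] _.
have z0 : z != 0 by apply: contraNneq zO => ->; rewrite rpred0.
by exists z^-1; rewrite ?invr_eq0 // -maxidealV.
Qed.

Lemma prime_elementP P t : t \in maxideal P -> t != 0 ->
  prime_element P t \/
  exists y, [/\ y \in maxideal P, y != 0 & t / y \in maxideal P].
Proof.
move=> tm t0;
  have [|H] := pselect (exists z, z \in maxideal P /\ t^-1 * z \notin vring P).
  case=> z [zm tz]; right; exists z.
  have z0 : z != 0 by apply: contraNneq tz => ->; rewrite mulr0 rpred0.
  split=> //; rewrite -[t / z]invrK -maxidealV ?invr_eq0 ?mulf_neq0 ?invr_eq0 //.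
  by rewrite invfM invrK.
left=> z; split=> [zm|[w wO ->]]; last exact: maxidealMr.
exists (t^-1 * z); last by rewrite mulVKf.
by apply: contrapT => /negP tz; apply: H; exists z.
Qed.

Lemma prime_element_mem P t : prime_element P t -> t \in maxideal P.
Proof. by move=> tP; apply/tP; exists 1; rewrite ?rpred1 ?mulr1. Qed.

Lemma prime_element_neq0 P t : prime_element P t -> t != 0.
Proof.
move=> tP; have [x xm] := maxideal_neq0 P; apply: contraNneq => t0.
by have /tP[w _ ->] := xm; rewrite t0 mul0r.
Qed.

(* Otherwise x would start arbitrarily long chains of proper divisors. *)
Lemma prime_element_ex P : exists t, prime_element P t.
Proof.
apply: contrapT => noprime; have [x xm x0] := maxideal_neq0 P.
have [f fP] : exists f : F -> F, forall y, y \in maxideal P -> y != 0 ->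
    [/\ f y \in maxideal P, f y != 0 & y / f y \in maxideal P].
  suff /choice[f fP] : forall y, exists z, y \in maxideal P -> y != 0 ->
    [/\ z \in maxideal P, z != 0 & y / z \in maxideal P] by exists f.
  move=> y.
  have [ym|ym] := boolP (y \in maxideal P); last by exists 0.
  have [->|y0] := eqVneq y 0; first by exists 0.
  case: (prime_elementP ym y0) => [yP|[z zP]]; last by exists z.
  by case: noprime; exists y.
have ym i : iter i f x \in maxideal P /\ iter i f x != 0.
  by elim: i => //= i [ym y0]; case: (fP _ ym y0).
have yy i j : (i < j)%N -> iter i f x / iter j f x \in maxideal P.
  elim: j => // j IHj; rewrite ltnS leq_eqVlt => /predU1P[->|/IHj yyi].
    by case: (ym j) => yj yj0; case: (fP _ yj yj0).
  case: (ym j) => yj yj0; case: (fP _ yj yj0) => _ _ /maxideal_vring yjO.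
  by have := maxidealMr yyi yjO; rewrite mulrA divfK.
have [B hB] := kx_free_bounded hF x.
have := hB _ _ (@kx_free_chain _ _ _ P x B.+1 (fun i => iter i f x)
  xm x0 (fun i _ => ym i) _ (fun i j ij _ => yy i j ij)).
rewrite card_ord ltnn; move=> H; suff: false by []; apply: H => -[|i] _;
  first by rewrite divff ?rpred1.
by apply: maxideal_vring; apply: (yy 0).
Qed.

(** Up to inversion z is in the maximal ideal. The exponent is the largest n with z / t^n integral,
    and maximality makes that quotient a unit; such an n exists because a long chain of powers of t
    dividing z would be independent over k[z]. *)
Lemma prime_element_factor P t z : prime_element P t -> z != 0 ->
  exists (n : int) u, u \in vunit P /\ z = t ^ n * u.
Proof.
move=> tP z0; have t0 := prime_element_neq0 tP; have tm := prime_element_mem tP.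
wlog zm : z z0 / z \in maxideal P => [IH|].
  have [zm|zm] := boolP (z \in maxideal P); first exact: IH.
  have [zO|zO] := boolP (z \in vring P).
    by exists 0, z; rewrite vunit_maxideal // expr0z mul1r.
  have [||n [u [uu zE]]] := IH z^-1;
    [by rewrite invr_eq0|by rewrite -maxidealV|].
  exists (- n), u^-1; rewrite vunitV; split=> //.
  by rewrite -[z]invrK zE invfM invr_expz.
have [B hB] := kx_free_bounded hF z.
pose C n := z / t ^+ n \in vring P.
have C1 : exists n, C n.
  by exists 0%N; rewrite /C expr0 divr1 maxideal_vring.
have CB n : C n -> (n <= B)%N.
  case: n => // n Cn.
  (* The chain is z, t^n, ..., t. Here z / t^(n+1) is integral, so z comes strictly before t^n. *)
  pose y i := if i == 0%N then z else t ^+ (n.+1 - i).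
  have zE m : z / t ^+ m = z / t ^+ n.+1 * (t ^+ n.+1 / t ^+ m).
    by rewrite mulrA divfK ?expf_neq0.
  have := hB _ _ (@kx_free_chain _ _ _ P z n.+1 y zm z0 _ _ _).
  rewrite card_ord; apply=> [i lin|i lin|i j lij ljn].
  - rewrite /y; case: eqP => // _; rewrite expf_neq0 //; split=> //.
    by rewrite subSn // exprS maxidealMr ?rpredX // maxideal_vring.
  - rewrite /y; case: eqP => [_|i0]; first by rewrite divff ?rpred1.
    rewrite zE rpredM //.
    by rewrite -expfB_cond ?(negPf t0) ?leq_subr // rpredX ?maxideal_vring.
  rewrite /y; have -> : (j == 0%N) = false by case: (j) lij.
  case: eqP => [i0|i0].
    rewrite zE maxidealMl //.
    rewrite -expfB_cond ?(negPf t0) ?leq_subr //.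
    rewrite subKn 1?ltnW // -(prednK (leq_ltn_trans _ lij)) //.
    by rewrite exprS maxidealMr ?rpredX // maxideal_vring.
  rewrite -expfB_cond ?(negPf t0) ?leq_sub2l 1?ltnW //.
  have -> : (n.+1 - i - (n.+1 - j) = (j - i).-1.+1)%N by lia.
  by rewrite exprS maxidealMr ?rpredX // maxideal_vring.
case: (ex_maxnP C1 CB) => n Cn nmax; exists n%:Z, (z / t ^+ n).
rewrite -exprnP vunit_maxideal // mulrCA divff ?expf_neq0 // mulr1; split=> //.
apply/negP => /tP[w wO zE]; have := nmax n.+1; rewrite ltnn => /(_ _)/negP[] //.
by rewrite /C exprSr invfM mulrA zE mulrC mulKf.
Qed.

Lemma prime_element_unit P t t' : prime_element P t -> prime_element P t' ->
  t' / t \in vunit P.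
Proof.
move=> tP tP'; have t0 := prime_element_neq0 tP.
have t'0 := prime_element_neq0 tP'.
have /tP[w wO t'E] := prime_element_mem tP'.
have /tP'[w' wO' tE] := prime_element_mem tP.
have e1 : t' / t = w by rewrite t'E mulrC mulKf.
have e2 : t / t' = w' by rewrite tE mulrC mulKf.
by rewrite vunitE mulf_neq0 ?invr_eq0 // invf_div e1 e2 wO wO'.
Qed.

Lemma prime_element_expz P t (n : int) : prime_element P t ->
  t ^ n \in vunit P -> n = 0.
Proof.
move=> tP; have tm := prime_element_mem tP.
have tX i : t ^+ i.+1 \notin vunit P.
  have tiO : t ^+ i \in vring P by rewrite rpredX ?maxideal_vring.
  rewrite exprS vunit_maxideal ?negbK; first exact: maxidealMr.
  by apply: rpredM => //; apply: maxideal_vring.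
case: n => [[|n]|n] //; first by rewrite -exprnP (negPf (tX _)).
by rewrite NegzE -exprnN vunitV (negPf (tX _)).
Qed.

Lemma valuationE P t (n : int) u : prime_element P t -> u \in vunit P ->
  valuation P (t ^ n * u) = n.
Proof.
move=> tP uu; have t0 := prime_element_neq0 tP.
apply: xget_unique => [|n' [t' [u' [tP' uu' E]]]]; first by exists t, u.
have t'0 := prime_element_neq0 tP'.
apply/esym/eqP; rewrite -subr_eq0; apply/eqP/(prime_element_expz tP).
have eu := prime_element_unit tP tP'.
have /and3P[u0 _ _] := uu.
suff -> : t ^ (n - n') = (t' / t) ^ n' * (u' / u).
  by rewrite vunitM ?vunitX // vunitM ?vunitV.
rewrite expfzDr // expfzMl exprz_inv -[t ^ n](mulfK u0) E.
by rewrite [in RHS]mulrAC mulrA.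
Qed.

Lemma valuation_prime P t : prime_element P t -> valuation P t = 1.
Proof.
by move=> tP; rewrite -[in LHS](mulr1 t) -[t]expr1z valuationE ?vunit1.
Qed.

Lemma uniformizer_ex P : exists2 t, t != 0 & valuation P t = 1.
Proof.
have [t tP] := prime_element_ex P.
by exists t; [exact: prime_element_neq0 tP|exact: valuation_prime].
Qed.

Lemma valuationM P z w : z != 0 -> w != 0 ->
  valuation P (z * w) = valuation P z + valuation P w.
Proof.
move=> z0 w0; have [t tP] := prime_element_ex P.
have t0 := prime_element_neq0 tP.
have [n [u [uu ->]]] := prime_element_factor tP z0.
have [n' [u' [uu' ->]]] := prime_element_factor tP w0.
by rewrite mulrACA -expfzDr // !valuationE ?vunitM.
Qed.

Lemma valuation_unit P u : u \in vunit P -> valuation P u = 0.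
Proof.
move=> uu; have [t tP] := prime_element_ex P.
by rewrite -(valuationE 0 tP uu) expr0z mul1r.
Qed.

Lemma valuation1 P : valuation P 1 = 0.
Proof. by rewrite valuation_unit ?vunit1. Qed.

(** No t^n u vanishes, so 0 receives the default value; a nonzero valuation therefore certifies a
    nonzero element. *)
Lemma valuation0 P : valuation P 0 = 0.
Proof.
apply: xgetPN => n [t [u [tP /and3P[u0 _ _] /esym/eqP]]].
by rewrite mulf_eq0 (negPf u0) orbF (negPf (expfz_neq0 _ (prime_element_neq0 tP))).
Qed.

Lemma valuation_const P c : valuation P (iota c) = 0.
Proof.
have [->|c0] := eqVneq c 0; first by rewrite rmorph0 valuation0.
by rewrite valuation_unit // vunit_maxideal ?vring_const ?maxideal_const.
Qed.

Lemma valuationV P z : valuation P z^-1 = - valuation P z.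
Proof.
have [->|z0] := eqVneq z 0; first by rewrite invr0 valuation0.
have := valuationM P (invr_neq0 z0) z0; rewrite (mulVf z0) valuation1.
by move/esym/eqP; rewrite addr_eq0 => /eqP.
Qed.

Lemma valuationX P z n : valuation P (z ^+ n) = valuation P z *+ n.
Proof.
elim: n => [|n IHn]; first by rewrite expr0 valuation1.
have [->|z0] := eqVneq z 0.
  by rewrite expr0n /= valuation0 mul0rn.
by rewrite exprS mulrS valuationM ?expf_neq0 // IHn.
Qed.

Lemma valuationXz P z (n : int) : valuation P (z ^ n) = valuation P z * n.
Proof.
case: n => n; first by rewrite -exprnP valuationX -mulr_natr natz.
by rewrite NegzE -exprnN valuationV valuationX mulrN -mulr_natr natz.
Qed.

Lemma valuation_gt0 P z : z != 0 -> (0 < valuation P z) = (z \in maxideal P).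
Proof.
have pos w : w \in maxideal P -> w != 0 -> 0 < valuation P w.
  have [t tP] := prime_element_ex P => wm w0; have := prime_element_mem tP.
  have [n [u [uu wE]]] := prime_element_factor tP w0 => tm.
  rewrite wE valuationE //; case: n wE => [[|n]|n] //.
    by rewrite expr0z mul1r => wE; move: wm; rewrite inE wE uu andbF.
  rewrite NegzE -exprnN => wE; have /and3P[u0 _ uVO] := uu.
  have : 1 \in maxideal P.
    rewrite (_ : 1 = w * (t ^+ n.+1 * u^-1)).
      by rewrite maxidealMr ?rpredM ?rpredX ?(maxideal_vring tm).
    have t0 := expf_neq0 n.+1 (prime_element_neq0 tP).
    by rewrite wE mulrACA mulVf // mul1r divff.
  by rewrite maxideal1.
move=> z0; apply/idP/idP=> [vz|/pos->//].
rewrite -[z \in _]negbK; apply/negP => zm; move: vz.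
have [zO|] := boolP (z \in vring P);
  first by rewrite valuation_unit ?vunit_maxideal.
rewrite maxidealV // => /pos; rewrite invr_eq0 valuationV oppr_gt0 => /(_ z0).
by move=> /ltW; rewrite leNgt => /negPf->.
Qed.

Lemma valuation_ge0 P z : z != 0 -> (0 <= valuation P z) = (z \in vring P).
Proof.
move=> z0; rewrite leNgt -oppr_gt0 -valuationV valuation_gt0 ?invr_eq0 //.
by rewrite -maxidealV // negbK.
Qed.

Definition vge P (a : int) z := (z == 0) || (a <= valuation P z).

Lemma vge0 P z : vge P 0 z = (z \in vring P).
Proof.
rewrite /vge; have [->|z0] := eqVneq z 0; first by rewrite rpred0.
exact: valuation_ge0.
Qed.

Lemma vge1 P z : vge P 1 z = (z \in maxideal P).
Proof.
rewrite /vge; have [->|z0] := eqVneq z 0; first by rewrite maxideal0.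
by rewrite -valuation_gt0.
Qed.

Lemma vge_zero P a : vge P a 0.
Proof. by rewrite /vge eqxx. Qed.

Lemma vge_le P a b z : a <= b -> vge P b z -> vge P a z.
move=> ab; rewrite /vge => /orP[->//|bz].
by rewrite (le_trans ab bz) orbT.
Qed.

Lemma vgeM P a b z w : vge P a z -> vge P b w -> vge P (a + b) (z * w).
Proof.
rewrite /vge; have [->|z0] := eqVneq z 0; first by rewrite mul0r eqxx.
have [->|w0 /= az bw] := eqVneq w 0; first by rewrite mulr0 eqxx.
by rewrite valuationM // lerD ?orbT.
Qed.

Lemma vgeM_valuation P a z w : z != 0 ->
  vge P (a + valuation P z) (w * z) = vge P a w.
Proof.
move=> z0; apply/idP/idP => [H|H]; last by rewrite vgeM // /vge lexx orbT.
have : vge P (- valuation P z) z^-1 by rewrite /vge valuationV lexx orbT.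
by move=> /(vgeM H); rewrite mulfK // addrK.
Qed.

(** Multiplication by t^(-a) moves the bound to 0, where the ultrametric inequality is just closure
    of the valuation ring under addition. *)
Lemma vgeD P a z w : vge P a z -> vge P a w -> vge P a (z + w).
Proof.
have [t t0 vt] := uniformizer_ex P.
have vta : valuation P (t ^ (- a)) = - a by rewrite valuationXz vt mul1r.
have ta0 : t ^ (- a) != 0 by rewrite expfz_neq0.
rewrite -3!(vgeM_valuation P a _ ta0) vta subrr !vge0.
by rewrite mulrDl => *; rewrite rpredD.
Qed.

Lemma vgeN P a z : vge P a (- z) = vge P a z.
Proof.
have vN w : vge P a w -> vge P a (- w).
  by move=> aw; rewrite -mulN1r -[a]add0r vgeM // vge0 rpredN rpred1.
by apply/idP/idP => /vN //; rewrite opprK.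
Qed.

Lemma vgeB P a z w : vge P a z -> vge P a w -> vge P a (z - w).
Proof. by move=> az aw; rewrite vgeD ?vgeN. Qed.

Lemma vge_sum P a (I : Type) (r : seq I) (C : pred I) (f : I -> F) :
  (forall i, C i -> vge P a (f i)) -> vge P a (\sum_(i <- r | C i) f i).
Proof.
by move=> fm; elim/big_ind: _ => // [|z w]; [exact: vge_zero|exact: vgeD].
Qed.

Lemma vgeMl P a z w : z \in vring P -> vge P a w -> vge P a (z * w).
Proof. by rewrite -vge0 -{2}[a]add0r; exact: vgeM. Qed.

Lemma vge_constM P a c w : vge P a w -> vge P a (iota c * w).
Proof. by apply: vgeMl; exact: vring_const. Qed.

Lemma vge_self P z : vge P (valuation P z) z.
Proof. by rewrite /vge lexx orbT. Qed.

(** Discrete valuation rings are maximal subrings: if z in the larger ring has negative order at P,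
    then any y is [y / z ^+ n] times [z ^+ n] with the first factor integral at P, so the larger
    ring would be all of F. *)
Lemma place_subset P P' : {subset vring P <= vring P'} -> P = P'.
Proof.
move=> sub; apply: place_inj => z; apply/idP/idP; first exact: sub.
move=> zO'; apply: contraT => zO.
have z0 : z != 0 by apply: contraNneq zO => ->; rewrite rpred0.
have vz : valuation P z < 0 by rewrite ltNge valuation_ge0.
case: (vringP P') => _ _ _ [y /negP yO'] _; case: yO'.
have [->|y0] := eqVneq y 0; first by rewrite rpred0.
pose n := `|valuation P y|%N.
suff : y / z ^+ n \in vring P'.
  by move=> ?; rewrite -(divfK (expf_neq0 n z0) y) rpredM ?rpredX.
apply: sub; rewrite -valuation_ge0 ?mulf_neq0 ?invr_eq0 ?expf_neq0 //.
by rewrite valuationM ?invr_eq0 ?expf_neq0 // valuationV valuationX; nia.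
Qed.

End Valuation.

(** * Existence of places *)

Section PlaceExistence.
Variables (k : finFieldType) (F : fieldType) (iota : {rmorphism k -> F}).
Variable y : F.
Implicit Types (R : set F) (z : F).

(** Excluding the inverse of y makes y R a proper ideal; in a maximal such ring y ends up in the
    maximal ideal. *)
Definition subring_avoiding R : Prop :=
  [/\ forall a b, R a -> R b -> R (a - b),
      forall a b, R a -> R b -> R (a * b),
      forall c, R (iota c), R y & ~ R y^-1].

Section Closure.
Variable R : set F.
Hypothesis hR : subring_avoiding R.

Let RB a b : R a -> R b -> R (a - b). Proof. by case: hR => H _ _ _ _;
  exact: H. Qed.
Let RM a b : R a -> R b -> R (a * b). Proof. by case: hR => _ H _ _ _;
  exact: H. Qed.
Let Rc c : R (iota c). Proof. by case: hR. Qed.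
Let Ry : R y. Proof. by case: hR. Qed.
Let RVy : ~ R y^-1. Proof. by case: hR. Qed.
Let R0 : R 0. Proof. by rewrite -(rmorph0 iota). Qed.
Let R1 : R 1. Proof. by rewrite -(rmorph1 iota). Qed.
Let RD a b : R a -> R b -> R (a + b).
Proof. by move=> Ra Rb; rewrite -[b]opprK -[- b]sub0r; apply: RB => //;
  apply: RB. Qed.
Let y0 : y != 0.
Proof. by apply/eqP => y0; apply: RVy; rewrite y0 invr0. Qed.

Let I : set F := [set y * r | r in R].
Let ID a b : I a -> I b -> I (a + b).
Proof. by move=> [r Rr <-] [r' Rr' <-]; exists (r + r');
  [exact: RD|rewrite mulrDr]. Qed.
Let IM a b : R a -> I b -> I (a * b).
Proof. by move=> Ra [r Rr <-]; exists (a * r); [exact: RM|rewrite mulrCA]. Qed.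
Let IR a : I a -> R a.
Proof. by move=> [r Rr <-]; exact: RM. Qed.
Let I0 : I 0. Proof. by exists 0; rewrite ?mulr0. Qed.

(* Chevalley's descent: [p] and [q] with coefficients in y R both taking the
   value 1, at z and 1/z, can be combined into a polynomial of smaller size. *)
Let no_relation N z (p q : {poly F}) : z != 0 -> (size p + size q <= N)%N ->
  (forall i, I p`_i) -> (forall i, I q`_i) -> p.[z] = 1 -> q.[z^-1] = 1 -> False.
Proof.
elim: N z p q => [|N IHN] z p q z0.
  rewrite leqn0 addn_eq0 => /andP[/eqP sp _] _ _ pz _.
  move/eqP: sp pz; rewrite size_poly_eq0 => /eqP->;
    rewrite horner0 => /esym/eqP.
  by rewrite oner_eq0.
wlog le_qp : z z0 p q / (size q <= size p)%N => [IH|].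
  have [le|/ltnW le] := leqP (size q) (size p); first exact: (IH z z0 p q).
  move=> hN Ip Iq pz qz; apply: (IH z^-1 _ q p) => //; rewrite ?invr_eq0 //.
    by rewrite addnC.
  by rewrite invrK.
move=> hN Ip Iq pz qz.
have [sp1|sp1] := leqP (size p) 1.
  have [r Rr yr] := Ip 0%N; apply: RVy.
  suff -> : y^-1 = r by [].
  by apply: (mulfI y0); rewrite divff // yr -pz {1}(size1_polyC sp1) hornerC.
pose n := (size p).-1; have sp : size p = n.+1 by rewrite prednK // ltnW.
pose a := p`_n; pose b := q`_0.
(* Multiplying q(1/z) = 1 by z^n gives s(z) = (1 - b) z^n with s of degree below n. So in (1 - b) p
   the leading term (1 - b) a z^n may be replaced by a s(z), and adding b restores the value 1. *)
pose s := \sum_(j < n) q`_j.+1 *: 'X^(n - j.+1).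
pose p' := b%:P + (1 - b) *: take_poly n p + a *: s.
have sz : s.[z] = (1 - b) * z ^+ n.
  have qn : (size q <= n.+1)%N by rewrite -sp.
  rewrite -qz (horner_coef_wide _ qn) big_ord_recl expr0 mulr1.
  rewrite [_ + \sum_(_ < _) _]addrC addrK mulr_suml horner_sum.
  apply: eq_bigr => j _; rewrite lift0 hornerZ hornerXn -mulrA; congr (_ * _).
  by rewrite exprVn mulrC -expfB_cond ?(negPf z0) ?ltn_ord.
have pz' : p'.[z] = 1.
  have pzE : p.[z] = (take_poly n p).[z] + a * z ^+ n.
    rewrite -{1}(poly_take_drop n p) hornerD hornerM hornerXn;
      congr (_ + _ * _).
    have : (size (drop_poly n p) <= 1)%N by rewrite size_drop_poly sp subSnn.
    by move=> /size1_polyC ->; rewrite hornerC coef_drop_poly add0n.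
  have E : (take_poly n p).[z] = 1 - a * z ^+ n by rewrite -pz pzE addrK.
  rewrite !hornerD hornerC !hornerZ sz E mulrCA -addrA -mulrDr subrK mulr1.
  by rewrite addrC subrK.
have Ia : I a by exact: Ip.
have R1b : R (1 - b) by exact: RB R1 (IR (Iq 0%N)).
apply: (IHN z p' q) => //.
- rewrite -ltnS; apply: leq_trans hN; rewrite sp ltn_add2r ltnS.
  have n0 : (0 < n)%N by rewrite -ltnS -sp.
  apply: (leq_trans (size_polyD _ _)); rewrite geq_max; apply/andP; split.
    apply: (leq_trans (size_polyD _ _)); rewrite geq_max; apply/andP; split.
      by rewrite (leq_trans (size_polyC_leq1 _)).
    by rewrite (leq_trans (size_scale_leq _ _)) // size_take_poly.
  rewrite (leq_trans (size_scale_leq _ _)) // (leq_trans (size_sum _ _ _)) //.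
  apply/bigmax_leqP => j _; rewrite (leq_trans (size_scale_leq _ _)) //.
  by rewrite size_polyXn subnSK ?leq_subr.
- move=> i; rewrite !coefD coefC !coefZ coef_take_poly.
  apply: ID; last first.
    rewrite mulrC; apply: IM => //; rewrite coef_sum.
    elim/big_ind: _ => // j _; rewrite coefZ coefXn.
    by case: eqP => _; rewrite ?mulr1 ?mulr0 //; apply/IR/Iq.
  apply: ID; first by case: ifP => // _; exact: Iq.
  by apply: IM => //; case: ifP => // _; exact: Ip.
Qed.

Let adjoin z : set F :=
  [set a | exists2 p : {poly F}, (forall i, R p`_i) & p.[z] = a].

Let adjoin_sub z a : R a -> adjoin z a.
Proof.
move=> Ra; exists a%:P; last by rewrite hornerC.
by move=> i; rewrite coefC; case: ifP.
Qed.

Let adjoin_mem z : adjoin z z.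
Proof.
exists 'X; last by rewrite hornerX.
by move=> i; rewrite coefX; case: (_ == _).
Qed.

Let adjoinB z a b : adjoin z a -> adjoin z b -> adjoin z (a - b).
Proof.
move=> [p Rp <-] [q Rq <-]; exists (p - q); last by rewrite hornerD hornerN.
by move=> i; rewrite coefB; apply: RB.
Qed.

Let adjoinM z a b : adjoin z a -> adjoin z b -> adjoin z (a * b).
Proof.
move=> [p Rp <-] [q Rq <-]; exists (p * q); last by rewrite hornerM.
by move=> i; rewrite coefM; elim/big_ind: _ => // *; exact: RM.
Qed.

Hypothesis Rmax : forall R', subring_avoiding R' -> R `<=` R' -> R' `<=` R.

(** R[z] is strictly larger than R, so by maximality it contains the inverse of y; multiply that
    expression by y. *)
Let maximal_relation z : ~ R z ->
  exists2 p : {poly F}, (forall i, I p`_i) & p.[z] = 1.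
Proof.
move=> Rz; have [p Rp pz] : adjoin z y^-1.
  apply: contrapT => nVy; apply: Rz.
  apply: (Rmax (R' := adjoin z)); last exact: adjoin_mem.
  - split=> //; [exact: adjoinB|exact: adjoinM|move=> c|]; exact: adjoin_sub.
  - by move=> a; exact: adjoin_sub.
exists (y *: p); last by rewrite hornerZ pz divff.
by move=> i; rewrite coefZ; exists p`_i.
Qed.

Lemma maximal_subring_avoiding_total z : R z \/ R z^-1.
Proof.
apply: contrapT => /not_orP[/maximal_relation[p Ip pz] RzV].
have z0 : z != 0 by apply/eqP => z0; apply: RzV; rewrite z0 invr0.
have [q Iq qz] := maximal_relation RzV.
exact: (no_relation z0 (leqnn _) Ip Iq).
Qed.

Lemma maximal_subring_avoiding_place :
  exists P : place iota, [set` vring P] = R.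
Proof.
pose O : {pred F} := [pred z | `[< R z >]].
have OP z : (z \in O) = `[< R z >] by [].
suff hO : valuation_ring iota O.
  by exists (Place hO); apply/seteqP; split=> z /=; rewrite OP => /asboolP.
split.
- split=> [|a b|a b]; rewrite !OP; first exact/asboolP.
    by move=> /asboolP Ra /asboolP Rb; apply/asboolP/RB.
  by move=> /asboolP Ra /asboolP Rb; apply/asboolP/RM.
- by move=> c; apply/asboolP.
- exists y => [|c]; first exact/asboolP.
  by apply/eqP => yc; apply: RVy; rewrite yc -fmorphV.
- by exists y^-1; apply/negP => /asboolP.
- move=> z; apply/orP; case: (maximal_subring_avoiding_total z) => Rz.
    by left; apply/asboolP.
  by right; apply/asboolP.
Qed.
End Closure.

Lemma place_containing R : subring_avoiding R ->
  exists P : place iota, R `<=` [set` vring P] /\ y \in maxideal P.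
Proof.
move=> hR.
(* The condition bears on A union R so that the empty chain, whose union is empty, is covered too;
   adjoining the empty set to the chain avoids a separate case. *)
have [F0 totF|A [hA Amax]] := @Zorn_bigcup F (fun A => subring_avoiding (A `|` R)).
  move=> F0P; pose F1 := F0 `|` [set set0].
  have F1P A : F1 A -> subring_avoiding (A `|` R).
    by case=> [|->]; [exact: totF|rewrite set0U].
  have F1tot A B : F1 A -> F1 B -> A `<=` B \/ B `<=` A.
    move=> [F0A|->] [F0B|->]; [exact: F0P|right|left|left]; exact: sub0set.
  set U := _ `|` _; have UP a : U a -> exists2 A, F1 A & (A `|` R) a.
    by case=> [[A ? ?]|?]; [exists A; left|exists set0; right].
  have sub A : F1 A -> A `|` R `<=` U.
    case=> [FA|->]; last by rewrite set0U => ? ?; right.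
    by move=> a [Aa|Ra]; [left; exists A|right].
  have UP2 a b : U a -> U b -> exists2 A, F1 A & (A `|` R) a /\ (A `|` R) b.
    move=> /UP[A FA Aa] /UP[B FB Bb].
    have [AB|BA] := F1tot A B FA FB; [exists B|exists A] => //; split=> //.
      exact: setSU Aa.
    exact: setSU Bb.
  split.
  - by move=> a b Ua Ub; have [A FA [Aa Ab]] := UP2 a b Ua Ub;
      apply: (sub A FA); case: (F1P A FA) => H *; apply: H.
  - by move=> a b Ua Ub; have [A FA [Aa Ab]] := UP2 a b Ua Ub;
      apply: (sub A FA); case: (F1P A FA) => _ H *; apply: H.
  - by move=> c; right; case: hR.
  - by right; case: hR.
  - by move=> /UP[A FA]; case: (F1P A FA).
have [|P PA] := @maximal_subring_avoiding_place _ hA.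
  move=> R' hR' sub; have AR' : A `<=` R' by move=> a Aa; apply: sub; left.
  apply: contrapT => nsub; apply: (Amax R').
    by split=> // R'A; apply: nsub => a /R'A; left.
  by rewrite setUidl // => a Ra; apply: sub; right.
exists P; rewrite PA; split; first by move=> a; right.
have in_P z : (z \in vring P) = (z \in A `|` R).
  by rewrite -PA; apply/idP/idP; rewrite inE.
have y0 : y != 0.
  by apply/eqP => y0; case: hR => _ _ _ Ry []; rewrite y0 invr0 -y0.
rewrite maxidealE in_P (negPf y0) /=; apply/negP; rewrite inE.
by case: hA.
Qed.
End PlaceExistence.

(** * Nonconstant functions have poles *)

Section Poles.
Variables (k : finFieldType) (F : fieldType) (iota : {rmorphism k -> F}).
Hypothesis hF : function_field iota.

(** A place where 1/z vanishes is sought, starting from the ring k[1/z]. If z = p(1/z), then 1/z is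
    a root of X p - 1, hence algebraic over k, hence constant. *)
Lemma pole_ex (z : F) : (forall c, z != iota c) ->
  exists P : place iota, z \notin vring P.
Proof.
move=> zc; pose R := [set a : F | exists p : {poly k}, a = (map_poly iota p).[z^-1]].
have z0 : z != 0 by rewrite -(rmorph0 iota).
have [|P [_ Pz]] := @place_containing _ _ iota z^-1 R; last first.
  by exists P; rewrite maxidealV.
split.
- by move=> _ _ [p ->] [q ->]; exists (p - q); rewrite rmorphB hornerD hornerN.
- by move=> _ _ [p ->] [q ->]; exists (p * q); rewrite rmorphM hornerM.
- by move=> c; exists c%:P; rewrite map_polyC hornerC.
- by exists 'X; rewrite map_polyX hornerX.
- rewrite invrK => -[p zp]; have [c] : exists c, z^-1 = iota c.
    apply: hF.2; exists ('X * p - 1).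
      apply/eqP => /(congr1 (fun q : {poly k} => q`_0));
        rewrite coefB coefXM coef1 coef0 /= sub0r.
      by move/eqP; rewrite oppr_eq0 oner_eq0.
    rewrite rootE rmorphB rmorphM rmorph1 /= map_polyX !hornerE -zp mulVf //.
    by rewrite subrr.
  by move/(congr1 GRing.inv); rewrite invrK -fmorphV => /eqP;
    rewrite (negPf (zc _)).
Qed.

Lemma no_pole_const (z : F) : (forall P : place iota, z \in vring P) ->
  exists c, z = iota c.
Proof.
move=> zO; apply: contrapT => zc; have [|P /negP[]//] := @pole_ex z.
by move=> c; apply/eqP => zE; apply: zc; exists c.
Qed.
End Poles.

(** * Weak approximation *)

Section Approximation.
Variables (k : finFieldType) (F : fieldType) (iota : {rmorphism k -> F}).
Hypothesis hF : function_field iota.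
Implicit Types (P Q : place iota) (x y z w t : F).

Lemma valuationD_lt P y z : y != 0 -> valuation P y < valuation P z ->
  valuation P (y + z) = valuation P y.
Proof.
move=> y0 lt_yz; have vzy : vge P (valuation P y + 1) z.
  by rewrite /vge lezD1 lt_yz orbT.
have vyz : vge P (valuation P y) (y + z).
  by rewrite (vgeD hF) ?vge_self // (vge_le _ vzy) // lerDl.
apply/eqP; rewrite eq_le; apply/andP; split.
  rewrite leNgt -lezD1; apply/negP => lt_y.
  have : vge P (valuation P y + 1) y.
    by rewrite -[X in vge _ _ X](addrK z) (vgeB hF) // /vge lt_y orbT.
  by rewrite /vge (negPf y0) gerDl ler10.
move: vyz; rewrite /vge => /orP[/eqP yz|//].
have zE : z = - y by apply/eqP; rewrite -addr_eq0 addrC yz.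
by move: vzy; rewrite zE (vgeN hF) /vge (negPf y0) gerDl ler10.
Qed.

(** Neither ring contains the other; the quotient of an element of O_P outside O_Q by an element of
    O_Q outside O_P has the required signs. *)
Lemma separate2 P Q : P <> Q -> exists2 y, 0 < valuation P y & valuation Q y < 0.
Proof.
have diff P1 P2 : P1 <> P2 -> exists2 z, z \in vring P1 & z \notin vring P2.
  move=> neq; apply: contrapT => H; apply/neq/(place_subset hF) => z z1.
  by apply: contraT => z2; case: H; exists z.
move=> neq; have [y yP yQ] := diff _ _ neq.
have [z zQ zP] := diff _ _ (nesym neq).
have y0 : y != 0 by apply: contraNneq yQ => ->; rewrite rpred0.
have z0 : z != 0 by apply: contraNneq zP => ->; rewrite rpred0.
exists (y / z); rewrite (valuationM hF) ?invr_eq0 // (valuationV hF);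
  move: yP yQ zP zQ; rewrite -!(valuation_ge0 hF) // -!ltNge; lia.
Qed.

Lemma separate P (s : seq (place iota)) : P \notin s ->
  exists2 x, 0 < valuation P x & forall Q, Q \in s -> valuation Q x < 0.
Proof.
elim: s => [_|Q s IHs].
  by have [t _ vt] := uniformizer_ex hF P; exists t; rewrite ?vt.
rewrite inE negb_or => /andP[/eqP neq /IHs[y yP ys]].
have [yQ|yQ] := ltP (valuation Q y) 0.
  by exists y => // R; rewrite inE => /predU1P[->//|/ys].
have [z zP zQ] := separate2 neq.
have y0 : y != 0 by apply: contraTneq yP => ->; rewrite valuation0.
have z0 : z != 0 by apply: contraTneq zP => ->; rewrite valuation0.
(* With n this large the orders of y and [z ^+ n] differ at Q and at every place of s, and the
   smaller one is negative, so no cancellation can spoil the pole of the sum. *)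
pose n := (\sum_(R <- s) `|valuation R y|).+1%N.
have vzn (R : place iota) : valuation R (z ^+ n) = valuation R z * n%:Z.
  by rewrite (valuationX hF) -mulr_natr natz.
have zn0 : z ^+ n != 0 by rewrite expf_neq0.
exists (y + z ^+ n) => [|R].
  have : vge P 1 (y + z ^+ n).
    rewrite (vgeD hF) // /vge ?(negPf y0) ?(negPf zn0) /=; last by rewrite vzn;
      nia.
    by lia.
  rewrite /vge => /orP[/eqP yz|]; last by lia.
  have : valuation Q (- y) = valuation Q (z ^+ n).
    by congr valuation; apply/eqP; rewrite eq_sym -addr_eq0 addrC yz.
  have := vge_self P (- y).
  have : vge Q 0 (- y) by rewrite (vgeN hF) /vge yQ orbT.
  rewrite /vge oppr_eq0 (negPf y0) /= vzn => vy _ vyz; exfalso; nia.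
have vznQ : valuation Q (z ^+ n) < valuation Q y by rewrite vzn; nia.
rewrite inE => /predU1P[->|Rs]; first by rewrite addrC valuationD_lt // vzn;
  nia.
have yR := ys R Rs.
have ltn : (`|valuation R y| < n)%N by rewrite ltnS (big_rem _ Rs) leq_addr.
have [zR|zR] := ltP (valuation R z) 0.
  by rewrite addrC valuationD_lt // vzn; nia.
by rewrite valuationD_lt // vzn; nia.
Qed.

(** For x vanishing at P with poles on s, 1 / (1 + x^m) is close to 1 at P and close to 0 on s, to
    an order growing with m. *)
Lemma approximate_idempotent P (s : seq (place iota)) (n : nat) : P \notin s ->
  exists e, vge P n (e - 1) /\ forall Q, Q \in s -> vge Q n e.
Proof.
move=> /separate[x xP xs]; pose m := n.+1.
have x0 : x != 0 by apply: contraTneq xP => ->; rewrite valuation0.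
have xm0 : x ^+ m != 0 by rewrite expf_neq0.
have vx (Q : place iota) : valuation Q (x ^+ m) = valuation Q x * m%:Z.
  by rewrite (valuationX hF) -mulr_natr natz.
have vP : valuation P (1 + x ^+ m) = 0.
  have v1 := valuation1 hF P.
  by rewrite valuationD_lt ?oner_neq0 // v1 vx; nia.
have vs (Q : place iota) : Q \in s -> valuation Q (1 + x ^+ m) <= - n%:Z.
  move=> /xs xQ; have v1 := valuation1 hF Q.
  by rewrite addrC valuationD_lt // ?v1 vx; nia.
have [e0|e0] := eqVneq (1 + x ^+ m) 0.
  exists 0; split=> [|Q _]; last exact: vge_zero.
  have xE : x ^+ m = - 1 by apply/eqP; rewrite -addr_eq0 addrC e0.
  by rewrite sub0r -xE /vge vx; apply/orP; right; nia.
exists (1 + x ^+ m)^-1; split=> [|Q Qs].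
  rewrite (_ : _ - 1 = - (x ^+ m * (1 + x ^+ m)^-1)).
    rewrite (vgeN hF) /vge (valuationM hF) ?invr_eq0 // (valuationV hF) vP vx.
    by apply/orP; right; nia.
  apply: (mulIf e0); rewrite mulNr mulrBl divfK // mulVf //.
  by rewrite mul1r opprD addNKr.
rewrite /vge (valuationV hF); have := vs Q Qs.
by move=> ?; apply/orP; right; lia.
Qed.

Lemma approximate (I : finType) (P : I -> place iota) (z : I -> F) (n : nat) :
  injective P -> exists w, forall i, vge (P i) n (w - z i).
Proof.
(* The sum compensates the poles of the z j, which would otherwise reduce the precision of e j * z
   j. *)
move=> injP; pose N := (n + \sum_(ij : I * I) `|valuation (P ij.1) (z ij.2)|)%N.
have [e eP] : exists e : I -> F, forall j, vge (P j) N (e j - 1) /\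
    forall i, i != j -> vge (P i) N (e j).
  suff /choice[e eP] : forall j, exists e, vge (P j) N (e - 1) /\
    forall i, i != j -> vge (P i) N e by exists e.
  move=> j; have [|e [e1 e2]] :=
      @approximate_idempotent (P j) [seq P i | i <- enum I & i != j] N.
    by apply/mapP => -[i]; rewrite mem_filter => /andP[/negPf ij _] /injP/eqP;
      rewrite eq_sym ij.
  exists e; split=> // i ij; apply: e2; apply: map_f.
  by rewrite mem_filter ij mem_enum.
have vN i j x : vge (P i) N x -> vge (P i) n (x * z j).
  move=> xN; apply: vge_le (vgeM hF xN (vge_self (P i) (z j))).
  have : (`|valuation (P i) (z j)| <= \sum_(ij : I * I) `|valuation (P ij.1) (z ij.2)|)%N.
    by rewrite (bigD1 (i, j)) //= leq_addr.
  by rewrite /N; lia.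
exists (\sum_j e j * z j) => i.
rewrite (bigD1 i) //= addrAC -{2}[z i]mul1r -mulrBl.
apply: (vgeD hF); first by apply: vN; case: (eP i).
by apply: (vge_sum hF) => j ji; apply: vN; case: (eP j) => _; apply;
  rewrite eq_sym.
Qed.

(** K is a parameter because two sets of constants occur: the constants of the field itself, and in
    F' the image of k, a priori smaller than k'. *)
Definition residue_free (K : set F) P (J : finType) (u : J -> F) : Prop :=
  (forall j, u j \in vring P) /\
  forall c : J -> F, (forall j, K (c j)) ->
    \sum_j c j * u j \in maxideal P -> forall j, c j = 0.


(** The system is triangular: when the coefficients below index j vanish, reducing modulo t^(j+1)
    and dividing by t^j leaves a relation between the residues of the u a. *)
Lemma residue_free_jets (K : set F) P (e g : nat) (u : 'I_g -> F) t
    (c : 'I_e -> 'I_g -> F) : valuation P t = 1 ->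
  (forall a, K a -> a \in vring P) -> residue_free K P u ->
  (forall j a, K (c j a)) ->
  vge P e (\sum_(j < e) \sum_a c j a * (t ^+ j * u a)) ->
  forall j a, c j a = 0.
Proof.
move=> vt KO [uO ufree] Kc vS.
have t0 : t != 0 by apply: contra_eq_neq vt => ->; rewrite valuation0.
suff H n : forall (j : 'I_e) a, (j < n)%N -> c j a = 0.
  by move=> j a; exact: (H e).
elim: n => // n IHn j a; rewrite ltnS leq_eqVlt => /predU1P[jn|];
  last exact: IHn.
apply: (ufree (c j)) => //; rewrite -(vge1 hF).
have vtX i : valuation P (t ^+ i) = i%:Z by rewrite (valuationX hF) vt natz.
rewrite -(vgeM_valuation hF P 1 _ (expf_neq0 j t0)) vtX mulr_suml.
have vS1 : vge P (1 + j%:Z) (\sum_(j < e) \sum_a c j a * (t ^+ j * u a)).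
  by apply: vge_le vS; have := ltn_ord j; lia.
rewrite (eq_bigr (fun a => c j a * (t ^+ j * u a))); last first.
  by move=> b _; rewrite mulrAC -mulrA.
rewrite (bigD1 j) //= in vS1.
rewrite -[X in vge _ _ X](addrK (\sum_(i | i != j) \sum_a c i a * (t ^+ i * u a))).
apply: (vgeB hF) => //; apply: (vge_sum hF) => i ij; apply: (vge_sum hF) => b _.
have [ltij|leji] := ltnP i j.
  by rewrite IHn ?mul0r ?vge_zero // -jn.
apply: (vgeMl hF); first exact/KO.
rewrite mulrC; apply: (vgeMl hF) => //; rewrite /vge vtX.
have : (j != i :> nat) by apply: contra ij => /eqP ji; apply/eqP/val_inj.
by move=> ?; apply/orP; right; lia.
Qed.

(* The family w lifts the basis t_i^j u_i of the sum of the O_i / t_i^(e i). *)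
Lemma residue_lift (K : set F) (I : finType) (P : I -> place iota)
    (e g : I -> nat) (u : forall i, 'I_(g i) -> F) :
  injective P -> (forall a i, K a -> a \in vring (P i)) ->
  (forall i, residue_free K (P i) (u i)) ->
  exists w : {i : I & ('I_(e i) * 'I_(g i))%type} -> F,
    (forall s i, w s \in vring (P i)) /\
    forall c, (forall s, K (c s)) ->
      (forall i, vge (P i) (e i) (\sum_s c s * w s)) -> forall s, c s = 0.
Proof.
move=> injP KO ufree.
have [t vt] : exists t : I -> F, forall i, valuation (P i) (t i) = 1.
  suff /choice[t vt] : forall i, exists t, valuation (P i) t = 1 by exists t.
  by move=> i; have [t _ vt] := uniformizer_ex hF (P i); exists t.
have tO i : t i \in vring (P i) by rewrite -(vge0 hF) /vge vt orbT.
pose T := {i : I & ('I_(e i) * 'I_(g i))%type}.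
pose z (s : T) := t (tag s) ^+ (tagged s).1 * u (tag s) (tagged s).2.
have zO s : z s \in vring (P (tag s)).
  by rewrite rpredM ?rpredX //; case: (ufree (tag s)) => ->.
(* A common precision at least every e i: modulo it, w s equals z s at its own place and 0 at the
   others. *)
pose M := (\sum_i e i)%N.
have [w wP] : exists w : T -> F, forall s i,
    vge (P i) M (w s - (if tag s == i then z s else 0)).
  suff /choice[w wP] : forall s : T, exists w, forall i,
      vge (P i) M (w - (if tag s == i then z s else 0)) by exists w.
  by move=> s; apply: approximate.
have eM i : (e i)%:Z <= M by rewrite lez_nat /M (bigD1 i) //= leq_addr.
exists w; split=> [s i|c Kc vS].
  rewrite -[w s](subrK (if tag s == i then z s else 0)) rpredD //.
    by rewrite -(vge0 hF); apply: vge_le (wP s i).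
  by case: eqP => [<-|_]; rewrite ?rpred0.
pose mk i (p : 'I_(e i) * 'I_(g i)) : T := existT _ i p.
suff c0 i j a : c (mk i (j, a)) = 0 by case=> i [j a]; exact: c0.
pose ci j a := c (mk i (j, a)); rewrite -/(ci j a).
have ciK j' a' : K (ci j' a') by exact: Kc.
apply: (residue_free_jets (vt i) (fun b => KO b i) (ufree i) ciK).
rewrite pair_big /=.
have -> : \sum_p ci p.1 p.2 * (t i ^+ p.1 * u i p.2)
    = \sum_s c s * (if tag s == i then z s else 0).
  pose G l (p : 'I_(e l) * 'I_(g l)) :=
     c (mk l p) * (if l == i then z (mk l p) else 0).
  transitivity (\sum_l \sum_(p : 'I_(e l) * 'I_(g l)) G l p).
    rewrite [RHS](bigD1 i) //= [X in _ + X]big1 => [|l li]; last first.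
      by apply: big1 => p _; rewrite /G (negPf li) mulr0.
    by rewrite addr0; apply: eq_bigr => -[j' a'] _; rewrite /G eqxx.
  rewrite (sig_big_dep (fun _ => true) (fun _ _ => true) G) /=.
  by apply: eq_bigr => -[].
rewrite -[X in vge _ _ X](subrK (\sum_s c s * w s)) -sumrB.
apply: (vgeD hF) => //; apply: (vge_sum hF) => s _; rewrite -mulrBr.
apply: (vgeMl hF); first exact: KO.
by rewrite -(vgeN hF) opprB; apply: vge_le (wP s i).
Qed.

End Approximation.

(** * Residue degrees, degrees of zeros, truncated expansions *)

Lemma card_sigT (I : finType) (T : I -> finType) :
  #|{: {i : I & T i}}| = (\sum_i #|T i|)%N.
Proof. by rewrite card_tagged sumnE big_map big_enum. Qed.

Section Degrees.
Variables (k : finFieldType) (F : fieldType) (iota : {rmorphism k -> F}).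
Hypothesis hF : function_field iota.
Implicit Types (P Q : place iota) (x y z w t : F).

(** In a relation over k[x] the combination of the constant terms is a multiple of x with integral
    cofactor, so it has order at least e i at each P i, and the lifted family forces these constants
    to vanish. *)
Lemma kx_free_zeros x (I : finType) (P : I -> place iota) (e g : I -> nat)
    (u : forall i, 'I_(g i) -> F) : x != 0 -> injective P ->
  (forall i, valuation (P i) x = (e i)%:Z) ->
  (forall i, residue_free (range iota) (P i) (u i)) ->
  exists (T : finType) (w : T -> F),
    #|T| = (\sum_i e i * g i)%N /\ kx_free iota x w.
Proof.
move=> x0 injP vx ufree.
have [|w [wO wP]] := residue_lift hF e injP _ ufree.
  by move=> _ i [c _ <-]; exact: vring_const.
exists {i : I & ('I_(e i) * 'I_(g i))%type}, w; split.
  by rewrite card_sigT; apply: eq_bigr => i _; rewrite card_prod !card_ord.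
apply: kx_free_criterion => // c r sum0 s; apply: (fmorph_inj iota).
rewrite rmorph0; move: s; apply: wP => [s|i]; first by exists (c s).
have xO : x \in vring (P i) by rewrite -(valuation_ge0 hF) ?vx.
rewrite (_ : \sum_s _ = - (x * \sum_s (map_poly iota (r s)).[x] * w s)).
  rewrite (vgeN hF) mulrC; apply: (vgeMl hF).
    by apply: rpred_sum => s _; apply: rpredM; [exact: vring_horner|exact: wO].
  by rewrite -vx vge_self.
apply/eqP; rewrite -addr_eq0 mulr_sumr -big_split -[X in _ == X]sum0; apply/eqP.
by apply: eq_bigr => s _ /=; rewrite mulrDl !mulrA.
Qed.

(** One zero P of x already yields v_P(x) g elements independent over k[x], with v_P(x) > 0. *)
Lemma residue_free_bounded P : exists B, forall g (u : 'I_g -> F),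
  residue_free (range iota) P u -> (g <= B)%N.
Proof.
have [x xm x0] := maxideal_neq0 P.
have [B hB] := kx_free_bounded hF x; exists B => g u ufree.
have vx : 0 < valuation P x by rewrite (valuation_gt0 hF).
have [|||T [w [cT wfree]]] := @kx_free_zeros x unit (fun=> P)
  (fun=> `|valuation P x|%N) (fun=> g) (fun=> u) x0.
- by move=> [] [].
- by move=> _; lia.
- by [].
have := hB _ _ wfree; rewrite cT big_const card_unit /= addn0; nia.
Qed.

Lemma residue_basis_free P d (u : 'I_d -> F) :
  residue_basis P u -> residue_free (range iota) P u.
Proof.
case=> uO ub; split=> // c cK cm; have O0 : 0 \in vring P by rewrite rpred0.
have [c0 [_ c0u]] := ub 0 O0.
have [c' c'E] : exists c' : 'I_d -> k, forall j, c j = iota (c' j).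
  suff /choice[c' H] : forall j, exists a, c j = iota a by exists c'.
  by move=> j; case: (cK j) => a _ <-; exists a.
have e0 : c0 = 0.
  apply: c0u; rewrite big1 ?subr0 ?maxideal0 // => i _.
  by rewrite mxE rmorph0 mul0r.
have e1 : c0 = \row_j c' j.
  apply: c0u; rewrite sub0r maxidealN (eq_bigr (fun j => c j * u j)) // => i _.
  by rewrite mxE c'E.
move=> j; have := congr1 (fun c : 'rV[k]_d => c 0 j) (etrans (esym e1) e0).
by rewrite !mxE c'E => ->; rewrite rmorph0.
Qed.

Lemma residue_basis_ex P : exists d, exists u : 'I_d -> F, residue_basis P u.
Proof.
pose C g := `[< exists u : 'I_g -> F, residue_free (range iota) P u >].
have C0 : exists g, C g.
  exists 0%N; apply/asboolP; exists (fun=> 0).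
  by split=> [j|c _ _ j]; [rewrite rpred0|case: j].
have [B hB] := residue_free_bounded P.
have CB g : C g -> (g <= B)%N by move=> /asboolP[u /hB].
case: (ex_maxnP C0 CB) => g /asboolP[u [uO ufree]] gmax; exists g, u;
  split=> // z zO.
have uniq_c (c c' : 'rV[k]_g) : z - \sum_(i < g) iota (c 0 i) * u i \in maxideal P ->
    z - \sum_(i < g) iota (c' 0 i) * u i \in maxideal P -> c = c'.
  move=> cm c'm; apply/rowP => i; apply/eqP; rewrite -subr_eq0; apply/eqP.
  apply: (fmorph_inj iota); rewrite rmorph0.
  move: i; apply: ufree => [j|]; first by exists (c 0 j - c' 0 j).
  have := maxidealB c'm cm; rewrite opprB addrC addrA subrK -sumrB.
  by under eq_bigr do rewrite -mulrBl -rmorphB.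
suff [c cP] : exists c : 'rV[k]_g, z - \sum_(i < g) iota (c 0 i) * u i \in maxideal P.
  by exists c; split=> // c'; exact: uniq_c.
apply: contrapT => noc.
pose u' (i : 'I_g.+1) := if unlift ord0 i is Some j then u j else z.
have := gmax g.+1; rewrite ltnn => /(_ _)/negP[]//; apply/asboolP; exists u'.
split=> [i|c cK].
  by rewrite /u'; case: unliftP.
rewrite big_ord_recl /u' unlift_none.
rewrite (eq_bigr (fun i : 'I_g => c (fintype.lift ord0 i) * u i)) => [cm|i _];
  last by rewrite liftK.
have [c' c'E] : exists c' : 'I_g.+1 -> k, forall j, c j = iota (c' j).
  suff /choice[c' H] : forall j, exists a, c j = iota a by exists c'.
  by move=> j; case: (cK j) => a _ <-; exists a.
have [c'0|c'0] := eqVneq (c' ord0) 0.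
  move: cm; rewrite c'E c'0 rmorph0 mul0r add0r => cm.
  move=> j; case: (unliftP ord0 j) => [i|] ->; last by rewrite c'E c'0 rmorph0.
  by apply: (ufree (fun i : 'I_g => c (fintype.lift ord0 i))) => // l;
    exact: cK.
case: noc; exists (\row_i (- c' (fintype.lift ord0 i) / c' ord0)).
have := maxidealMl (vring_const P (c' ord0)^-1) cm.
rewrite mulrDr c'E mulrA -rmorphM mulVf // rmorph1 mul1r => cm'.
rewrite (_ : - _ = iota ((c' ord0)^-1) * \sum_(i < g) c (fintype.lift ord0 i) * u i) //.
rewrite mulr_sumr -sumrN; apply: eq_bigr => i _.
by rewrite c'E mxE mulrA -rmorphM mulNr rmorphN mulNr opprK [_^-1 * _]mulrC.
Qed.

Lemma place_degreeP P : exists u : 'I_(place_degree P) -> F, residue_basis P u.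
Proof. exact: (xgetPex 0%N (residue_basis_ex P)). Qed.

Lemma place_degree_gt0 P : (0 < place_degree P)%N.
Proof.
have [u [_ ub]] := place_degreeP P; rewrite lt0n; apply/eqP => d0.
have O1 : 1 \in vring P by rewrite rpred1.
have [c [+ _]] := ub 1 O1; rewrite big1 ?subr0 ?maxideal1 //.
by move=> i; have := ltn_ord i; rewrite {2}d0.
Qed.

Definition zeros x : set (place iota) := [set P | x \in maxideal P].

Lemma kx_free_zeros_seq x (s : seq (place iota)) : x != 0 -> uniq s ->
  {in s, forall P, x \in maxideal P} ->
  exists (T : finType) (w : T -> F), kx_free iota x w /\
    #|T| = (\sum_(P <- s) `|valuation P x| * place_degree P)%N.
Proof.
move=> x0 us sm; pose P (i : 'I_(size s)) := tnth (in_tuple s) i.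
have [u ub] : exists u : forall i, 'I_(place_degree (P i)) -> F,
    forall i, residue_basis (P i) (u i).
  exists (fun i => projT1 (cid (place_degreeP (P i)))) => i.
  exact: projT2 (cid (place_degreeP (P i))).
have [|||T [w [cT wfree]]] := @kx_free_zeros x _ P
  (fun i => `|valuation (P i) x|%N) _ u x0.
- by apply/tuple_uniqP.
- move=> i; have : x \in maxideal (P i) by apply: sm; exact: mem_tnth.
  by rewrite -(valuation_gt0 hF) //; lia.
- by move=> i; exact: residue_basis_free.
by exists T, w; split=> //; rewrite cT [RHS]big_tnth.
Qed.

(** Each zero contributes at least one element to a family independent over k[x], and such families
    are bounded. *)
Lemma finite_zeros x : x != 0 -> finite_set (zeros x).
Proof.
move=> x0; apply: contrapT => inf.
have [B hB] := kx_free_bounded hF x.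
have [s sz Bs] := infinite_set_fset B.+1 inf.
have sm : {in enum_fset s, forall P, x \in maxideal P} by move=> P /sz.
have [T [w [wfree cT]]] := kx_free_zeros_seq x0 (fset_uniq s) sm.
have := leq_trans Bs (leq_trans _ (hB _ _ wfree));
  rewrite ltnn => /(_ _)/negP[] //.
rewrite cT -sum1_size big_seq [X in (_ <= X)%N]big_seq.
apply: leq_sum => P /sm; rewrite -(valuation_gt0 hF) // => vx.
by have := place_degree_gt0 P; nia.
Qed.

Lemma mem_zeros x P : x != 0 ->
  (P \in fset_set (zeros x)) = (x \in maxideal P).
Proof.
move=> x0; rewrite in_fset_set; last exact: finite_zeros.
by apply/idP/idP => [/set_mem|xm]; [|exact/mem_set].
Qed.

Definition zero_degree x : nat :=
  (\sum_(P <- fset_set (zeros x)) `|valuation P x| * place_degree P)%N.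

Lemma kx_free_zero_degree x : x != 0 ->
  exists (T : finType) (w : T -> F), kx_free iota x w /\ #|T| = zero_degree x.
Proof.
move=> x0; apply: kx_free_zeros_seq (fset_uniq _) _ => // P.
by rewrite mem_zeros.
Qed.

Lemma finite_poles x : finite_set [set P : place iota | x \notin vring P].
Proof.
have [->|x0] := eqVneq x 0.
  by apply: sub_finite_set (finite_set0 _) => P /=; rewrite rpred0.
apply: sub_finite_set (finite_zeros (invr_neq0 x0)) => P /=.
by rewrite maxidealV.
Qed.

(* J z collects the coefficients of z at t^a, ..., t^(a + l - 1) in its t-adic
   expansion, t being a uniformizer. *)
Lemma jets P (a : int) (l : nat) : exists (X : finType) (J : F -> X),
  #|X| = (#|k| ^ (l * place_degree P))%N /\
  forall z w, vge P a z -> vge P a w -> J z = J w -> vge P (a + l) (z - w).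
Proof.
elim: l a => [|l IHl] a.
  exists unit, (fun=> tt); split=> [|z w az aw _]; first by rewrite card_unit.
  by rewrite addr0 (vgeB hF).
have [t t0 vt] := uniformizer_ex hF P.
have [u [uO ub]] := place_degreeP P.
have [c cP] : exists c : F -> 'rV[k]_(place_degree P), forall z, z \in vring P ->
    z - \sum_i iota (c z 0 i) * u i \in maxideal P.
  suff /choice[c cP] : forall z, exists c : 'rV[k]_(place_degree P), z \in vring P ->
    z - \sum_i iota (c 0 i) * u i \in maxideal P by exists c.
  move=> z; have [zO|zO] := boolP (z \in vring P); last by exists 0.
  by have [c [cz _]] := ub z zO; exists c.
have [X [J [cX JP]]] := IHl (a + 1).
(* [hd z] lifts the residue of t^(-a) z, so [tl z] gains one order; equal leading coefficients
   cancel in [z - w]. *)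
pose hd z := \sum_i iota (c (t ^ (- a) * z) 0 i) * u i.
pose tl z := z - t ^ a * hd z.
exists ('rV[k]_(place_degree P) * X)%type, (fun z => (c (t ^ (- a) * z), J (tl z))).
split=> [|z w az aw [eq_c eq_J]].
  by rewrite card_prod cX card_mx mul1n -expnD mulSn.
have tlP y : vge P a y -> vge P (a + 1) (tl y).
  move=> ay; have va : valuation P (t ^ a) = a by rewrite (valuationXz hF) vt mul1r.
  have ta0 : t ^ a != 0 by rewrite expfz_neq0.
  rewrite (_ : tl y = (t ^ (- a) * y - hd y) * t ^ a).
    rewrite addrC -{1}va (vgeM_valuation hF) // (vge1 hF); apply: cP.
    rewrite -(vge0 hF) -(addNr a); apply: (vgeM hF) => //.
    by rewrite /vge (valuationXz hF) vt mul1r lexx orbT.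
  rewrite mulrBl mulrAC -invr_expz mulVf // mul1r /tl.
  by rewrite [hd y * _]mulrC.
have := JP _ _ (tlP z az) (tlP w aw) eq_J.
rewrite /tl /hd eq_c opprB addrCA addrA subrKC addrC.
by rewrite -addrA [1 + _]addrC -[l%:Z + 1]/(l%:Z + 1%:Z) -PoszD addn1.
Qed.

Lemma jets_seq (s : seq (place iota)) (a : place iota -> int)
    (l : place iota -> nat) : exists (X : finType) (J : F -> X),
  #|X| = (#|k| ^ (\sum_(P <- s) l P * place_degree P))%N /\
  forall z w, {in s, forall P, vge P (a P) z} -> {in s, forall P, vge P (a P) w} ->
    J z = J w -> {in s, forall P, vge P (a P + l P) (z - w)}.
Proof.
elim: s => [|Q s [X [J [cX JP]]]].
  by exists unit, (fun=> tt); rewrite big_nil card_unit.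
have [Y [J' [cY J'P]]] := jets Q (a Q) (l Q).
exists (Y * X)%type, (fun z => (J' z, J z)).
rewrite card_prod cX cY -expnD big_cons; split=> // z w az aw [eq1 eq2] P.
rewrite inE => /predU1P[->|Ps].
  by apply: J'P => //; [apply: az|apply: aw]; rewrite inE eqxx.
by apply: JP => // R Rs; [apply: az|apply: aw]; rewrite inE Rs orbT.
Qed.

End Degrees.

(** * Degree of principal divisors *)

Section PrincipalDivisors.
Variables (k : finFieldType) (F : fieldType) (iota : {rmorphism k -> F}).
Hypothesis hF : function_field iota.
Implicit Types (P Q : place iota) (x y z w t : F).

Lemma zero_degree_seq x (s : seq (place iota)) : x != 0 -> uniq s ->
  (forall P, x \in maxideal P -> P \in s) ->
  zero_degree iota x = (\sum_(P <- s)
    (if x \in maxideal P then `|valuation P x|%N else 0%N) * place_degree P)%N.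
Proof.
move=> x0 us sm; rewrite /zero_degree.
rewrite [RHS](bigID (fun P => x \in maxideal P)) /= [X in _ = (_ + X)%N]big1;
  last first.
  by move=> P /negPf->.
suff pe : perm_eq (fset_set (zeros x : set (place iota))) [seq P <- s | x \in maxideal P].
  by rewrite addn0 (perm_big _ pe) big_filter; apply: eq_bigr => P ->.
apply: uniq_perm; [exact: fset_uniq|exact: filter_uniq|] => P.
rewrite mem_filter mem_zeros //.
by apply/idP/andP => [xm|[]//]; split=> //; exact: sm.
Qed.

Lemma kx_free_le_poles x (I : finType) (u : I -> F) :
  (forall c, x != iota c) -> kx_free iota x u ->
  (#|I| <= zero_degree iota x^-1)%N.
Proof.
move=> xc ufree; have x0 : x != 0 by rewrite -(rmorph0 iota).
have polesE P : (x \notin vring P) = (x^-1 \in maxideal P) by rewrite maxidealV.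
pose A := [set P : place iota | x \notin vring P] `|`
  \bigcup_(i in [set: I]) [set P : place iota | u i \notin vring P].
have finA : finite_set A.
  rewrite finite_setU; split; first exact: finite_poles.
  apply: bigcup_finite => [|i _]; last exact: finite_poles.
  exact: finite_finset.
pose s := enum_fset (fset_set A).
have sA P : (P \in s) = `[< A P >] by rewrite in_fset_set // asboolE;
  exact/idP/idP; rewrite inE.
have us : uniq s by exact: fset_uniq.
pose eps P := if x^-1 \in maxideal P then `|valuation P x^-1|%N else 0%N.
have dE : zero_degree iota x^-1 = (\sum_(P <- s) eps P * place_degree P)%N.
  apply: zero_degree_seq => // [|P xm]; first by rewrite invr_eq0.
  by rewrite sA; apply/asboolP; left; rewrite /= polesE.
(* C bounds the pole orders of the u i. The polynomials have degree at most C', and their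
   combinations must match in C' * D + C' expansion coefficients; as #|I| > D, the #|I| * (C' + 1)
   unknowns exceed this number. *)
pose C := (\sum_(P <- s) \sum_i `|valuation P (u i)|)%N.
pose C' := (\sum_(P <- s) C.+1 * place_degree P)%N.
rewrite leqNgt; apply/negP => ltD; set D := zero_degree _ _ in ltD dE.
(* a P + l P = 1: equal expansions force the difference to vanish at P, not merely to be regular
   there. *)
pose a P := - (C' * eps P + C)%:Z; pose l P := (C' * eps P + C.+1)%N.
have [X [jet [cX jetP]]] := jets_seq hF s a l.
pose p (c : {ffun I * 'I_C'.+1 -> k}) i : {poly k} :=
  \sum_(j < C'.+1) c (i, j) *: 'X^j.
pose z c := \sum_i (map_poly iota (p c i)).[x] * u i.
have pE c i : (map_poly iota (p c i)).[x] = \sum_(j < C'.+1) iota (c (i, j)) * x ^+ j.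
  rewrite rmorph_sum horner_sum; apply: eq_bigr => j _ /=.
  by rewrite map_polyZ map_polyXn hornerZ hornerXn.
have za c : {in s, forall P, vge P (a P) (z c)}.
  move=> P Ps; apply: (vge_sum hF) => i _.
  rewrite /a PoszD opprD; apply: (vgeM hF); last first.
    apply: vge_le (vge_self P (u i)).
    have : (`|valuation P (u i)| <= C)%N.
      by rewrite /C (big_rem P) //= (bigD1 i) //= -addnA leq_addr.
    by lia.
  rewrite pE; apply: (vge_sum hF) => j _; apply: (vge_constM hF).
  have := ltn_ord j; rewrite ltnS => jC.
  rewrite /eps -polesE; case: ifPn => [xP|]; last first.
    rewrite negbK muln0 => xO; apply: vge_le (_ : vge P 0 _) => //.
    by rewrite (vge0 hF) rpredX.
  rewrite /vge (valuationX hF) (valuationV hF) -mulr_natr natz.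
  have : valuation P x < 0 by rewrite ltNge (valuation_ge0 hF).
  by move=> ?; apply/orP; right; nia.
have [|c [c' [neq_c eq_c]]] :=
    @finite_pigeonhole {ffun I * 'I_C'.+1 -> k} X (fun c => jet (z c)).
  rewrite cX card_ffun card_prod card_ord.
  rewrite ltn_exp2l ?card_finRing_gt1 //.
  have -> : (\sum_(P <- s) l P * place_degree P = C' * D + C')%N.
    rewrite dE /C' big_distrr -big_split; apply: eq_bigr => P _ /=.
    by rewrite -[in LHS]/(l P) /l mulnDl mulnA.
  by clear -ltD; nia.
have zB : z c - z c' = \sum_i (map_poly iota (p c i - p c' i)).[x] * u i.
  by rewrite -sumrB; apply: eq_bigr => i _;
    rewrite rmorphB hornerD hornerN mulrBl.
have zB1 P : P \in s -> z c - z c' \in maxideal P.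
  move=> Ps; rewrite -(vge1 hF); have := jetP _ _ (za c) (za c') eq_c P Ps.
  by congr (vge _ _ _); rewrite /a /l; lia.
have [|b zb] := no_pole_const hF (z := z c - z c').
  move=> P; have [/zB1/maxideal_vring//|Ps] := boolP (P \in s).
  rewrite zB; apply: rpred_sum => i _; apply: rpredM.
    apply: vring_horner; apply: contraNT Ps => xP; rewrite sA.
    by apply/asboolP; left.
  by apply: contraNT Ps => uP; rewrite sA; apply/asboolP; right; exists i.
(* A pole of x belongs to s, so the constant b vanishes at some place and is 0. *)
have [P xP] := pole_ex hF xc.
have b0 : b = 0.
  apply/eqP; rewrite -(maxideal_const P) -zb; apply: zB1.
  by rewrite sA; apply/asboolP; left.
have := ufree (fun i => p c i - p c' i);
  rewrite -zB zb b0 rmorph0 => /(_ erefl) pB.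
apply: neq_c; apply/ffunP => -[i j]; apply/eqP; rewrite -subr_eq0.
have /(congr1 (fun q : {poly k} => q`_j)) := pB i.
rewrite coefB coef0 !coef_sumMXn => /eqP.
by rewrite !(big_pred1 j).
Qed.

(** The zeros of y supply a free family whose size is bounded by the poles of y; applying this to x
    and to 1/x gives both inequalities. *)
Lemma zero_degreeV x : (forall c, x != iota c) ->
  zero_degree iota x^-1 = zero_degree iota x.
Proof.
have le y : (forall c, y != iota c) ->
    (zero_degree iota y <= zero_degree iota y^-1)%N.
  move=> yc; have y0 : y != 0 by rewrite -(rmorph0 iota).
  have [T [w [wfree <-]]] := kx_free_zero_degree hF y0.
  exact: (kx_free_le_poles yc wfree).
move=> xc; apply/eqP; rewrite eqn_leq le // andbT -{2}[x]invrK le // => c.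
by apply: contraNneq (xc c^-1) => xE; rewrite fmorphV -xE invrK.
Qed.

Lemma principal_divisor_degree x (s : seq (place iota)) : x != 0 -> uniq s ->
  (forall P, valuation P x != 0 -> P \in s) ->
  \sum_(P <- s) valuation P x * (place_degree P)%:Z = 0.
Proof.
move=> x0 us hs; have [[c ->]|xc] := pselect (exists c, x = iota c).
  by apply: big1 => P _; rewrite (valuation_const hF) mul0r.
have {}xc c : x != iota c by apply/eqP => xE; apply: xc; exists c.
have xVm P : (x^-1 \in maxideal P) = (valuation P x < 0).
  by rewrite -(valuation_gt0 hF) ?invr_eq0 // (valuationV hF) oppr_gt0.
have xm P : (x \in maxideal P) = (0 < valuation P x).
  by rewrite -(valuation_gt0 hF).
have := zero_degreeV xc.
rewrite (zero_degree_seq x0 us); last by move=> P; rewrite xm => *; apply: hs;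
  lia.
rewrite (zero_degree_seq (invr_neq0 x0) us); last first.
  by move=> P; rewrite xVm => *; apply: hs; lia.
move/(congr1 Posz)/esym/eqP; rewrite -subr_eq0 => /eqP degE.
rewrite -[RHS]degE !(big_morph Posz PoszD (erefl _)) -sumrB.
apply: eq_bigr => P _.
rewrite !PoszM -mulrBl; congr (_ * _); rewrite xm xVm (valuationV hF).
by do 2!case: ifP; lia.
Qed.
End PrincipalDivisors.

(** * Places above a place *)

Section PlacesAbove.
Variables (k k' : finFieldType) (F : fieldType) (F' : fieldExtType F).
Variables (iota : {rmorphism k -> F}) (iota' : {rmorphism k' -> F'}).
Hypotheses (hF : function_field iota) (hF' : function_field iota').
Implicit Types (P : place iota) (Q : place iota').

(* The elements of k are roots of polynomials X^i - X^j, hence algebraic over any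
   field. *)
Lemma const_lift c : exists c', (iota c)%:A = iota' c'.
Proof.
have [|i [j [ij cij]]] :=
    @finite_pigeonhole 'I_#|k|.+1 k (fun i => c ^+ i);
      first by rewrite card_ord.
apply: hF'.2; exists ('X^i - 'X^j).
  apply/eqP => /(congr1 (fun p : {poly k'} => p`_i));
    rewrite coefB !coefXn coef0.
  have -> : (i == j :> nat) = false by apply/eqP => /val_inj.
  by rewrite eqxx subr0 => /eqP; rewrite oner_eq0.
rewrite rootE rmorphB /= !map_polyXn !hornerE -in_algE -!rmorphXn /=.
by rewrite cij subrr.
Qed.

(** The ring is the intersection of O_Q with F; the given x shows that it contains a nonconstant
    element and is not all of F. *)
Lemma restrict_place Q (x : F) : x != 0 -> x%:A \in maxideal Q ->
  exists P, forall z, (z \in vring P) = (z%:A \in vring Q).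
Proof.
move=> x0 xm; pose O : {pred F} := [pred z | z%:A \in vring Q].
suff hO : valuation_ring iota O by exists (Place hO).
have OE z : (z \in O) = (in_alg F' z \in vring Q) by [].
split.
- split=> [|a b|a b]; rewrite !OE; first by rewrite rmorph1 rpred1.
    by rewrite rmorphB; exact: rpredB.
  by rewrite rmorphM; exact: rpredM.
- by move=> c; have [c' cE] := const_lift c; rewrite OE /= cE vring_const.
- exists x => [|c]; first exact: maxideal_vring.
  apply: contraTneq xm => xE; have [c' cE] := const_lift c.
  rewrite xE cE maxideal_const -(fmorph_eq0 iota') -cE.
  by rewrite -[_%:A]/(in_alg F' _) fmorph_eq0 -xE.
- exists x^-1; rewrite OE fmorphV maxidealV ?invr_eq0 ?fmorph_eq0 //.
  by rewrite invrK.
- by move=> z; rewrite !OE fmorphV -implyNb; apply/implyP/vring_total.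
Qed.

(** Inclusion of maximal ideals gives an inclusion of valuation rings by passing to inverses, and
    [place_subset] turns it into an equality. *)
Lemma lies_over_vring P Q : lies_over Q P ->
  forall z, (z \in vring P) = (z%:A \in vring Q).
Proof.
move=> over; have [x xm x0] := maxideal_neq0 P.
have [P1 P1E] := restrict_place x0 (over x xm).
suff -> : P = P1 by [].
apply/esym/(place_subset hF) => z; rewrite P1E => zO'; apply: contraT => zO.
have z0 : z != 0 by apply: contraNneq zO => ->; rewrite rpred0.
have := over z^-1; rewrite -maxidealV // => /(_ zO).
have zA0 : in_alg F' z != 0 by rewrite fmorph_eq0.
by rewrite -[_%:A]/(in_alg F' _) fmorphV -maxidealV // zO'.
Qed.

Lemma lies_over_maxideal P Q : lies_over Q P ->
  forall z, (z \in maxideal P) = (z%:A \in maxideal Q).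
Proof.
move=> over z; rewrite !maxidealE (lies_over_vring over).
by rewrite -[z%:A]/(in_alg F' z) fmorph_eq0 -fmorphV.
Qed.

Lemma lies_over_inj Q P1 P2 : lies_over Q P1 -> lies_over Q P2 -> P1 = P2.
Proof.
by move=> o1 o2; apply: place_inj => z;
  rewrite (lies_over_vring o1) (lies_over_vring o2).
Qed.

Lemma lies_over_ex Q (x : F) : x != 0 -> x%:A \in maxideal Q ->
  exists P, lies_over Q P.
Proof.
move=> x0 xm; have [P PE] := restrict_place x0 xm; exists P => z.
rewrite !maxidealE -[z%:A]/(in_alg F' _) fmorph_eq0 -fmorphV PE.
by [].
Qed.

(** The order at Q of a uniformizer of P serves as e, so the default value of [ramification_index]
    is not reached. *)
Lemma ramificationP P Q : lies_over Q P -> forall z, z != 0 ->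
  valuation Q z%:A = (ramification_index Q P)%:Z * valuation P z.
Proof.
move=> over; suff : exists e : nat, forall z : F, z != 0 ->
    valuation Q z%:A = e%:Z * valuation P z by exact: xgetPex.
have [t tP] := prime_element_ex hF P.
have t0 := prime_element_neq0 tP; have tm := prime_element_mem tP.
have tA0 : in_alg F' t != 0 by rewrite fmorph_eq0.
have vt : 0 < valuation Q t%:A.
  by rewrite (valuation_gt0 hF') // -(lies_over_maxideal over).
exists `|valuation Q t%:A|%N => z z0.
have [n [u [uu zE]]] := prime_element_factor hF tP z0.
have /and3P[u0 uO uVO] := uu.
have uA0 : in_alg F' u != 0 by rewrite fmorph_eq0.
rewrite zE (valuationE _ tP uu) -[_%:A]/(in_alg F' _) rmorphM fmorphXz.
rewrite (valuationM hF') ?expfz_neq0 // (valuationXz hF').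
rewrite [valuation _ u%:A](valuation_unit hF') ?addr0.
  by rewrite gez0_abs // ltW.
rewrite vunitE uA0 -[u%:A]/(in_alg F' u) -fmorphV.
by rewrite -(lies_over_vring over u) -(lies_over_vring over u^-1) uO.
Qed.

Lemma ramification_gt0 P Q : lies_over Q P -> (0 < ramification_index Q P)%N.
Proof.
move=> over; have [t t0 vt] := uniformizer_ex hF P.
have := ramificationP over t0; rewrite vt mulr1.
have : 0 < valuation Q t%:A.
  rewrite (valuation_gt0 hF') ?fmorph_eq0 //;
    last by rewrite (fmorph_eq0 (in_alg F')).
  by rewrite -(lies_over_maxideal over) -(valuation_gt0 hF) // vt.
by move=> + vE; rewrite vE ltz_nat.
Qed.

Lemma finite_places_above P : finite_set (places_above P : set (place iota')).
Proof.
have [x xm x0] := maxideal_neq0 P.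
have xA0 : x%:A != 0 :> F' by rewrite (fmorph_eq0 (in_alg F')).
by apply: sub_finite_set (finite_zeros hF' xA0) => Q over; exact: over.
Qed.

Lemma mem_places_above P Q :
  (Q \in fset_set (places_above P : set (place iota'))) = `[< lies_over Q P >].
Proof.
rewrite in_fset_set; last exact: finite_places_above.
by apply/idP/asboolP => [/set_mem|over]; [|exact/mem_set].
Qed.
End PlacesAbove.

(** * The fundamental equality *)

Section FundamentalInequality.
Variables (k k' : finFieldType) (F : fieldType) (F' : fieldExtType F).
Variables (iota : {rmorphism k -> F}) (iota' : {rmorphism k' -> F'}).
Hypotheses (hF : function_field iota) (hF' : function_field iota').

(** Division by a coefficient of least order makes a relation integral at P with one coefficient
    equal to 1. *)
Lemma max_quotient (P : place iota) (I : finType) (a : I -> F) :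
  (exists i, a i != 0) ->
  exists2 j, a j != 0 & forall i, a i / a j \in vring P.
Proof.
move=> [i0 ai0].
pose f i := valuation P (a i).
have [j aj jmin] : exists2 j, a j != 0 & forall i, a i != 0 -> f j <= f i.
  have [j aj H] := Order.TotalTheory.arg_minP f (P := fun i => a i != 0) ai0.
  by exists j.
exists j => // i; have [->|ai] := eqVneq (a i) 0; first by rewrite mul0r rpred0.
rewrite -(valuation_ge0 hF) ?mulf_neq0 ?invr_eq0 //.
by rewrite (valuationM hF) ?invr_eq0 // (valuationV hF) subr_ge0 jmin.
Qed.

Variables (P : place iota) (I : finType) (Q : I -> place iota').
Hypotheses (injQ : injective Q) (overQ : forall i, lies_over (Q i) P).

Let e i := ramification_index (Q i) P.
Let R : set F' := [set z | forall i, z \in vring (Q i)].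
(** This is pi R for any uniformizer pi of P, described without choosing one. *)
Let piR : set F' := [set z | forall i, vge (Q i) (e i) z].
Let piRD y z : piR y -> piR z -> piR (y + z).
Proof. by move=> py pz i; apply: (vgeD hF'). Qed.
Let piRB y z : piR y -> piR z -> piR (y - z).
Proof. by move=> py pz i; apply: (vgeB hF'). Qed.
Let piR_sum (J : finType) (f : J -> F') : (forall j, piR (f j)) -> piR (\sum_j f j).
Proof. by move=> pf i; apply: (vge_sum hF') => j _; apply: pf. Qed.
Let piR_scale a z : a \in vring P -> piR z -> piR (a *: z).
Proof.
move=> aO pz i; rewrite -mulr_algl; apply: (vgeMl hF') => //.
by rewrite -(lies_over_vring hF hF' (overQ i)).
Qed.
Let piR_max a z : a \in maxideal P -> R z -> piR (a *: z).
Proof.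
move=> am Rz i; rewrite -mulr_algl mulrC; apply: (vgeMl hF') => //.
have [->|a0] := eqVneq a 0; first by rewrite scale0r vge_zero.
rewrite /vge (ramificationP hF hF' (overQ i)) //; apply/orP; right.
have : 0 < valuation P a by rewrite (valuation_gt0 hF).
by rewrite -/(e i); move: (e i) => n; nia.
Qed.

Let indep n (r : 'I_n -> F') : Prop := (forall j, R (r j)) /\
  forall a : 'I_n -> F, (forall j, a j \in vring P) ->
    piR (\sum_j a j *: r j) -> forall j, a j \in maxideal P.

(** Independence modulo [piR] over the residue field of P lifts to independence over F: a relation
    over F, normalized by [max_quotient], would have 1 in the maximal ideal. *)
Let indep_dim n (r : 'I_n -> F') : indep r -> (n <= \dim {:F'})%N.
Proof.
move=> [rR rind]; have fr : free (mktuple r).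
  apply/freeP => a sum0 i; apply/eqP/contraT => ai.
  have [j aj jP] := max_quotient P (ex_intro _ i ai).
  suff : a j / a j \in maxideal P by rewrite divff // maxideal1.
  apply: (rind (fun i => a i / a j)) => //.
  rewrite (_ : \sum_l _ = (a j)^-1 *: \sum_l a l *: (mktuple r)`_l).
    by rewrite sum0 scaler0 => l; apply: vge_zero.
  rewrite scaler_sumr; apply: eq_bigr => l _.
  by rewrite scalerA mulrC -tnth_nth tnth_mktuple.
by rewrite -[n](size_tuple (mktuple r)) -(eqP fr) dimvS ?subvf.
Qed.

(* A maximal independent family generates R modulo piR. *)
Let generators : exists n (r : 'I_n -> F'), [/\ (n <= \dim {:F'})%N, forall j, R (r j) &
  forall z, R z -> exists2 a : 'I_n -> F, (forall j, a j \in vring P) &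
    piR (z - \sum_j a j *: r j)].
Proof.
pose C n := `[< exists r : 'I_n -> F', indep r >].
have C0 : exists n, C n.
  exists 0%N; apply/asboolP; exists (fun=> 0).
  by split=> [j|c _ _ j]; case: j.
have CB n : C n -> (n <= \dim {:F'})%N by move=> /asboolP[r /indep_dim].
case: (ex_maxnP C0 CB) => n Cn nmax; have := Cn => /asboolP[r [rR rind]].
exists n, r; split=> // [|z Rz]; first exact: CB.
apply: contrapT => noa.
pose r' (i : 'I_n.+1) := if unlift ord0 i is Some j then r j else z.
have := nmax n.+1; rewrite ltnn => /(_ _)/negP[]//; apply/asboolP; exists r'.
split=> [i|a aO]; first by rewrite /r'; case: unliftP.
rewrite big_ord_recl /r' unlift_none.
rewrite (eq_bigr (fun i : 'I_n => a (fintype.lift ord0 i) *: r i)); last first.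
  by move=> i _; rewrite liftK.
move=> pa; have [a0|a0] := boolP (a ord0 \in maxideal P).
  move=> j; case: (unliftP ord0 j) => [i|] -> //.
  apply: (rind (fun i : 'I_n => a (fintype.lift ord0 i))) => //.
  by have := piRB pa (piR_max a0 Rz); rewrite addrC addKr.
have a0n0 : a ord0 != 0 by apply: contraNneq a0 => ->; rewrite maxideal0.
have aVO : (a ord0)^-1 \in vring P.
  by move: a0; rewrite -(vunit_maxideal (aO ord0)) vunitE => /and3P[].
case: noa; exists (fun i => - (a ord0)^-1 * a (fintype.lift ord0 i)).
  by move=> j; rewrite rpredM ?rpredN.
have := piR_scale aVO pa; rewrite scalerDr scalerA mulVf // scale1r.
rewrite scaler_sumr -sumrN; congr (piR (_ + _)); apply: eq_bigr => i _.
by rewrite scalerA mulNr scaleNr opprK.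
Qed.

(* The elements of R that are k-independent modulo piR number at most
   n * deg P, since n generators over O_P / P have k-span of that size. *)
Lemma fundamental_inequality (g : I -> nat) (u : forall i, 'I_(g i) -> F') :
  (forall i, residue_free [set (iota c)%:A | c in [set: k]] (Q i) (u i)) ->
  (\sum_i ramification_index (Q i) P * g i <= \dim {:F'} * place_degree P)%N.
Proof.
move=> ufree; have [n [r [le_n rR rgen]]] := generators.
have [b [bO bb]] := place_degreeP hF P.
have KO c i : (iota c)%:A \in vring (Q i).
  by rewrite -(lies_over_vring hF hF' (overQ i)) vring_const.
have [|w [wO wP]] := residue_lift hF' e injQ _ ufree.
  by move=> _ i [c _ <-]; exact: KO.
pose T : finType := {i : I & ('I_(e i) * 'I_(g i))%type}.
pose z (c : {ffun T -> k}) := \sum_s (iota (c s))%:A * w s.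
have zR c : R (z c).
  by move=> i; apply: rpred_sum => s _; apply: rpredM; [exact: KO|exact: wO].
pose M (C : 'M[k]_(n, place_degree P)) :=
  \sum_j (\sum_l iota (C j l) * b l) *: r j.
have [C CP] : exists C : F' -> 'M[k]_(n, place_degree P),
    forall y, R y -> piR (y - M (C y)).
  suff /choice[C CP] : forall y, exists C, R y -> piR (y - M C) by exists C.
  move=> y; have [Ry|nRy] := pselect (R y); last by exists 0.
  have [a aO ya] := rgen y Ry.
  have [c cP] : exists c : 'I_n -> 'rV[k]_(place_degree P), forall j,
      a j - \sum_l iota (c j 0 l) * b l \in maxideal P.
    suff /choice[c cP] : forall j, exists c : 'rV[k]_(place_degree P),
        a j - \sum_l iota (c 0 l) * b l \in maxideal P by exists c.
    by move=> j; have [c [cP _]] := bb (a j) (aO j); exists c.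
  exists (\matrix_(j, l) c j 0 l) => _.
  rewrite -[y](subrK (\sum_j a j *: r j)) -addrA.
  apply: piRD => //; rewrite /M -sumrB; apply: piR_sum => j.
  rewrite -scalerBl; apply: piR_max => //.
  by under eq_bigr do rewrite mxE.
have [le|lt] := leqP #|T| (n * place_degree P).
  apply: (@leq_trans #|T|);
    last by rewrite (leq_trans le) // leq_mul2r le_n orbT.
  rewrite card_sigT leq_eqVlt; apply/orP; left; apply/eqP.
  by apply: eq_bigr => i _; rewrite card_prod !card_ord.
exfalso; have [|c [c' [neq_c eqC]]] :=
    @finite_pigeonhole {ffun T -> k} 'M[k]_(n, place_degree P) (fun c => C (z c)).
  by rewrite card_mx card_ffun ltn_exp2l // card_finRing_gt1.
apply: neq_c; apply/ffunP => s; apply/eqP; rewrite -subr_eq0.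
rewrite -(fmorph_eq0 iota) -(fmorph_eq0 (in_alg F')); apply/eqP.
move: s; apply: wP => [s|]; first by exists (c s - c' s).
suff : piR (z c - z c').
  rewrite -sumrB; congr piR; apply: eq_bigr => s _.
  by rewrite -mulrBl /= rmorphB scalerBl.
have := piRB (CP _ (zR c)) (CP _ (zR c')).
by rewrite eqC opprB addrA subrK.
Qed.
End FundamentalInequality.

Lemma fundamental_inequality_seq (k k' : finFieldType) (F : fieldType)
    (F' : fieldExtType F) (iota : {rmorphism k -> F}) (iota' : {rmorphism k' -> F'})
    (P : place iota) (s : seq (place iota')) (g : place iota' -> nat) :
  function_field iota -> function_field iota' -> uniq s ->
  {in s, forall Q, lies_over Q P} ->
  {in s, forall Q, exists u : 'I_(g Q) -> F',
    residue_free [set (iota c)%:A | c in [set: k]] Q u} ->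
  (\sum_(Q <- s) ramification_index Q P * g Q <= \dim {:F'} * place_degree P)%N.
Proof.
move=> hF hF' us over gfree; pose Q (i : 'I_(size s)) := tnth (in_tuple s) i.
have Qs i : Q i \in s by exact: mem_tnth.
pose u i := projT1 (cid (gfree (Q i) (Qs i))).
have ufree i := projT2 (cid (gfree (Q i) (Qs i))).
rewrite big_tnth; apply: (fundamental_inequality hF hF' _ _ ufree).
- exact/tuple_uniqP.
- by move=> i; apply: over.
Qed.

(** * Constants and residue fields above a rational place *)

Section ConstantExtension.
Variables (k k' : finFieldType) (F : fieldType) (F' : fieldExtType F).
Variables (iota : {rmorphism k -> F}) (iota' : {rmorphism k' -> F'}).
Hypotheses (hF : function_field iota) (hF' : function_field iota').
Implicit Types (P : place iota) (Q : place iota').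

(** The constants of F are constants of F', so a basis over k' stays independent over k. *)
Lemma residue_basis_free_above Q : exists u : 'I_(place_degree Q) -> F',
  residue_free [set (iota c)%:A | c in [set: k]] Q u.
Proof.
have [u ub] := place_degreeP hF' Q; exists u.
have [uO ufree] := residue_basis_free ub; split=> // a aK; apply: ufree => j.
by have [c _ <-] := aK j; have [c' ->] := const_lift iota hF' c; exists c'.
Qed.

Variable P : place iota.
Hypothesis Prat : rational_place P.
Hypothesis above : exists Q : place iota', lies_over Q P.
Hypothesis eP : forall Q : place iota', lies_over Q P ->
  (ramification_index Q P * nb_places_above iota' P)%N = \dim {:F'}.

Let s : seq (place iota') := fset_set (places_above P).
Let s_over : {in s, forall Q, lies_over Q P}.
Proof. by move=> Q; rewrite mem_places_above // => /asboolP. Qed.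

(** Summing the conorm condition over the m_P places above P gives m_P times the sum equal to m_P m,
    and m_P is nonzero because m is. *)
Lemma sum_ramification :
  (\sum_(Q <- s) ramification_index Q P)%N = \dim {:F'}.
Proof.
have [Q0 over0] := above; have := eP over0 => e0.
have nb0 : (0 < size s)%N.
  rewrite lt0n; apply/eqP => nb0; move: (adim_gt0 {:F'}%AS); rewrite -e0.
  by rewrite /nb_places_above -[#|` _|]/(size s) nb0 muln0.
apply/eqP; rewrite -(eqn_pmul2r nb0) big_distrl /= big_seq.
rewrite (eq_bigr (fun=> \dim {:F'})) => [|Q /s_over /eP//].
by rewrite -big_seq big_const_seq count_predT iter_addn_0 mulnC.
Qed.

(** A constant c' outside k would make 1 and c' independent over k at every place above P, and the
    fundamental inequality with g = 2 would read 2 m <= m. *)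
Lemma constants_of_rational c' : exists c, iota' c' = (iota c)%:A.
Proof.
apply: contrapT => nc'.
pose K : set F' := [set (iota c)%:A | c in [set: k]].
have KE (a : F') : K a -> exists c, a = (iota c)%:A.
  by case=> c _ <-; exists c.
have free2 : {in s, forall Q, exists u : 'I_2 -> F', residue_free K Q u}.
  move=> Q _; exists (fun i => if i == ord0 then 1 else iota' c').
  split=> [i|a aK]; first by case: eqP => _; rewrite ?rpred1 ?vring_const.
  have [a0 a0E] := KE _ (aK ord0);
    have [a1 a1E] := KE _ (aK (fintype.lift ord0 ord0)).
  have [b0 b0E] := const_lift iota hF' a0;
    have [b1 b1E] := const_lift iota hF' a1.
  rewrite big_ord_recl big_ord1 /= mulr1 a0E a1E b0E b1E -rmorphM -rmorphD.
  rewrite maxideal_const addr_eq0 => /eqP bE.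
  have b10 : b1 = 0.
    apply/eqP/contraT => b10; case: nc'; exists (- a0 / a1).
    apply: (mulfI (_ : iota' b1 != 0)); first by rewrite fmorph_eq0.
    have a10 : a1 != 0.
      by rewrite -(fmorph_eq0 iota) -(fmorph_eq0 (in_alg F')) /= b1E fmorph_eq0.
    have eqA : (iota a1)%:A * (iota (- a0 / a1))%:A = - (iota a0)%:A :> F'.
      rewrite -!in_algE -!rmorphM /= mulrC divfK // rmorphN.
      by rewrite -[_%:A]/(in_alg F' _) rmorphN.
    transitivity (- iota' b0); first by rewrite -rmorphM -rmorphN bE opprK.
    by rewrite -b1E eqA b0E.
  have a00 : a ord0 = 0 by rewrite a0E b0E bE b10 mul0r oppr0 rmorph0.
  have a10 : a (fintype.lift ord0 ord0) = 0 by rewrite a1E b1E b10 rmorph0.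
  by move=> j; case: (unliftP ord0 j) => [i|] -> //; rewrite (ord1 i).
have := fundamental_inequality_seq hF hF' (fset_uniq _) s_over free2.
rewrite (eqP Prat) muln1 -big_distrl /= sum_ramification.
have : (0 < \dim {:F'})%N := adim_gt0 {:F'}%AS.
by lia.
Qed.

(** The sum of e(Q|P) deg Q is at most m, which is already the sum of the e(Q|P); as all e(Q|P) and
    deg Q are positive, each degree is 1. *)
Lemma rational_above Q : lies_over Q P -> place_degree Q = 1%N.
Proof.
move=> over; have Qs : Q \in s by rewrite mem_places_above //; exact/asboolP.
have free1 : {in s, forall Q, exists u : 'I_(place_degree Q) -> F',
    residue_free [set (iota c)%:A | c in [set: k]] Q u}.
  by move=> Q1 _; exact: residue_basis_free_above.
have := fundamental_inequality_seq hF hF' (fset_uniq _) s_over free1.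
rewrite (eqP Prat) muln1 -sum_ramification.
rewrite !(big_rem _ Qs) /=.
have le : (\sum_(y <- rem Q s) ramification_index y P <=
    \sum_(y <- rem Q s) ramification_index y P * place_degree y)%N.
  apply: leq_sum => y _; have := place_degree_gt0 hF' y; nia.
have := place_degree_gt0 hF' Q; have := ramification_gt0 hF hF' over.
by move: le; do 2!move: (\sum_(y <- _) _)%N; move=> *; nia.
Qed.
End ConstantExtension.

(** * From the fundamental inequality to equality *)

Section ConormDegree.
Variables (k k' : finFieldType) (F : fieldType) (F' : fieldExtType F).
Variables (iota : {rmorphism k -> F}) (iota' : {rmorphism k' -> F'}).
Hypotheses (hF : function_field iota) (hF' : function_field iota').
Hypothesis hk : forall c', exists c, iota' c' = (iota c)%:A.
Implicit Types (P : place iota) (Q : place iota').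

Local Notation above P := (fset_set (places_above P : set (place iota'))).

(** Products of an F-basis of F' with a family of F free over k[x] are free over k[x] in F', since k
    and k' have the same image; the pole bound in F' then applies. *)
Lemma zero_degree_extension_ge (x : F) : (forall c, x != iota c) ->
  (\dim {:F'} * zero_degree iota x <= zero_degree iota' x%:A)%N.
Proof.
move=> xc; have x0 : x != 0 by rewrite -(rmorph0 iota).
have xc' c' : x%:A != iota' c'.
  have [c ->] := hk c'; apply: contra_neqN (xc c) => /eqP.
  exact: (fmorph_inj (in_alg F')).
have [T [w [wfree <-]]] := kx_free_zero_degree hF x0.
pose m := \dim {:F'}; pose b := vbasis {:F'}.
have bfree : free b by exact: (basis_free (vbasisP _)).
pose u (it : 'I_m * T) := b`_it.1 * (w it.2)%:A.
rewrite -(zero_degreeV hF' xc').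
apply: leq_trans (kx_free_le_poles hF' xc' (_ : kx_free iota' x%:A u)).
  by rewrite card_prod card_ord.
move=> p sum0.
(* [sg] inverts the identification of k with k'. It is kept as a plain function: coefficientwise
   transport of polynomials uses only [sg 0 = 0]. *)
have [sg sgE] : exists sg : k' -> k, forall c', iota' c' = (iota (sg c'))%:A.
  by have [sg sgE] := choice hk; exists sg.
have sg0 : sg 0 = 0.
  apply: (fmorph_inj iota); apply: (fmorph_inj (in_alg F')).
  by rewrite /= -sgE !rmorph0 scale0r.
pose q it := map_poly sg (p it).
have pE it : map_poly iota' (p it) = map_poly (in_alg F') (map_poly iota (q it)).
  by apply/polyP => i; rewrite !coef_map coef_map_id0 // /= sgE.
have qsum0 : forall i, \sum_t (map_poly iota (q (i, t))).[x] * w t = 0.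
  have /freeP := bfree; apply.
  transitivity (\sum_i \sum_t (map_poly iota' (p (i, t))).[x%:A] * u (i, t)).
    apply: eq_bigr => j _; rewrite scaler_suml; apply: eq_bigr => t _.
    rewrite pE -[x%:A]/(in_alg F' x) horner_map /u /=.
    by rewrite mulr_algl [b`_j * _]mulrC mulr_algl scalerA.
  by rewrite pair_bigA -[RHS]sum0 /=; apply: eq_bigr => -[].
have q0 i t : q (i, t) = 0 by exact: (wfree (fun t => q (i, t)) (qsum0 i)).
move=> [i t]; apply/polyP => j; apply: (fmorph_inj iota').
have := congr1 (fun f : {poly k} => f`_j) (q0 i t).
rewrite coef0 coef_map_id0 // => sg_j.
by rewrite sgE sg_j coef0 !rmorph0 scale0r.
Qed.

Lemma sum_places_above P (f : place iota' -> nat) (s : seq (place iota')) :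
  uniq s -> (forall Q, lies_over Q P -> Q \in s) ->
  (\sum_(Q <- s | `[< lies_over Q P >]) f Q =
   \sum_(Q <- above P) f Q)%N.
Proof.
move=> us hs; rewrite -big_filter; apply: perm_big.
apply: uniq_perm; [exact: filter_uniq|exact: fset_uniq|] => Q.
rewrite mem_filter mem_places_above //.
by apply/andP/idP => [[]//|over]; split=> //; apply: hs; exact/asboolP.
Qed.

(** Choose x vanishing at P. The inequalities at the zeros of x, weighted by their positive orders,
    add up to an equality by [zero_degree_extension_ge]; hence each of them, in particular the one
    at P, is an equality. *)
Lemma fundamental_equality P :
  (\sum_(Q <- above P) ramification_index Q P * place_degree Q
   = \dim {:F'} * place_degree P)%N.
Proof.
have le P1 : (\sum_(Q <- above P1)
    ramification_index Q P1 * place_degree Q <= \dim {:F'} * place_degree P1)%N.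
  apply: fundamental_inequality_seq (fset_uniq _) _ _ => // Q.
    by rewrite mem_places_above // => /asboolP.
  by move=> _; exact: residue_basis_free_above.
have [x xm x0] := maxideal_neq0 P.
have xc c : x != iota c.
  by apply: contraNneq x0 => xE; move: xm; rewrite xE maxideal_const => /eqP->;
    rewrite rmorph0.
have xA0 : x%:A != 0 :> F' by rewrite (fmorph_eq0 (in_alg F')).
have := zero_degree_extension_ge xc; rewrite /zero_degree.
set Z := fset_set (zeros x); set Z' := fset_set (zeros x%:A).
(* The zeros of x in F' are grouped by the unique place of F below them. *)
have -> : (\sum_(Q <- Z') `|valuation Q x%:A| * place_degree Q =
    \sum_(P1 <- Z) `|valuation P1 x| * \sum_(Q <- above P1)
      ramification_index Q P1 * place_degree Q)%N.
  transitivity (\sum_(Q <- Z') \sum_(P1 <- Z | `[< lies_over Q P1 >])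
      `|valuation Q x%:A| * place_degree Q)%N.
    rewrite big_seq [RHS]big_seq; apply: eq_bigr => Q;
      rewrite (mem_zeros hF') // => Qx.
    have [P1 over] := lies_over_ex iota hF' x0 Qx.
    rewrite (big_rem P1) /=; last first.
      by rewrite (mem_zeros hF) // (lies_over_maxideal hF hF' over).
    rewrite asboolT // big_seq_cond big1 ?addn0 // => P2.
    rewrite (mem_rem_uniq _ (fset_uniq _)) inE => /andP[/andP[/= /eqP neq _]].
    by move=> /asboolP over2; case: neq; apply: (lies_over_inj hF hF' over2).
  rewrite (exchange_big_dep xpredT) //= big_seq [RHS]big_seq;
    apply: eq_bigr => P1.
  rewrite (mem_zeros hF) // => P1x; rewrite sum_places_above ?fset_uniq //;
    last first.
    by move=> Q over; rewrite (mem_zeros hF') //; apply: over.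
  rewrite big_distrr /= big_seq [RHS]big_seq; apply: eq_bigr => Q.
  rewrite mem_places_above // => /asboolP over.
  by rewrite (ramificationP hF hF' over) // abszM mulnCA mulnA.
have PZ : P \in Z by rewrite (mem_zeros hF).
rewrite (big_rem P PZ) [X in (_ <= X)%N](big_rem P PZ) /=.
have vP : (0 < `|valuation P x|)%N.
  by rewrite absz_gt0 gt_eqF // (valuation_gt0 hF).
have ler : (\sum_(y <- rem P Z) `|valuation y x| *
      \sum_(Q <- above y) ramification_index Q y * place_degree Q
    <= \dim {:F'} * \sum_(y <- rem P Z) `|valuation y x| * place_degree y)%N.
  by rewrite big_distrr /=; apply: leq_sum => y _;
    rewrite mulnCA leq_mul2l le orbT.
move=> H; apply/eqP; rewrite eqn_leq le andTb.
suff : (`|valuation P x| * (\dim {:F'} * place_degree P) <= `|valuation P x| *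
    \sum_(Q <- above P) ramification_index Q P * place_degree Q)%N.
  by rewrite leq_pmul2l.
rewrite mulnCA -(leq_add2r
  (\dim {:F'} * \sum_(y <- rem P Z) `|valuation y x| * place_degree y)).
by rewrite -mulnDr (leq_trans H) // leq_add2l.
Qed.
End ConormDegree.

(** * Degrees of divisors and minimum distance *)

Section DivisorDegree.
Variables (k : finFieldType) (F : fieldType) (iota : {rmorphism k -> F}).
Implicit Types (G : divisor iota) (P : place iota).

Lemma divisor_degreeE G (s : seq (place iota)) : uniq s -> {subset dom G <= s} ->
  divisor_degree G = \sum_(P <- s) coeff P G * (place_degree P)%:Z.
Proof.
move=> us sub; rewrite [RHS](bigID (fun P => P \in dom G)) /=.
rewrite [X in _ = _ + X]big1 => [|P PG]; last by rewrite coeff_outdom ?mul0r.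
rewrite addr0 -big_filter; apply: perm_big; apply: uniq_perm.
- exact: uniq_dom.
- exact: filter_uniq.
- by move=> P; rewrite mem_filter andb_idr //; exact: sub.
Qed.

Lemma divisor_degreeD G1 G2 :
  divisor_degree (G1 + G2) = divisor_degree G1 + divisor_degree G2.
Proof.
pose s := undup (dom G1 ++ dom G2 ++ dom (G1 + G2)).
have us : uniq s := undup_uniq _.
rewrite !(divisor_degreeE us);
  try by move=> P PG; rewrite mem_undup !mem_cat PG ?orbT.
by rewrite -big_split; apply: eq_bigr => P _; rewrite coeffD mulrDl.
Qed.

Lemma divisor_degreeZ (a : int) G : divisor_degree (a *: G) = a * divisor_degree G.
Proof.
rewrite (divisor_degreeE (uniq_dom G)); last exact: domZ_subset.
by rewrite mulr_sumr; apply: eq_bigr => P _; rewrite coeffZ mulrA.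
Qed.

Lemma divisor_degree0 : divisor_degree (0 : divisor iota) = 0.
Proof. by rewrite /divisor_degree dom0 big_nil. Qed.

Lemma divisor_degreeU (a : int) P :
  divisor_degree (<< a *g P >> : divisor iota) = a * (place_degree P)%:Z.
Proof.
rewrite (@divisor_degreeE _ [:: P]) // => [|Q].
  by rewrite big_seq1 coeffU eqxx mulr1.
rewrite mem_dom coeffU inE; have [_|_] := eqVneq P Q; first by [].
by rewrite mulr0 eqxx.
Qed.

Lemma divisor_degree_sum (I : Type) (r : seq I) (f : I -> divisor iota) :
  divisor_degree (\sum_(i <- r) f i) = \sum_(i <- r) divisor_degree (f i).
Proof. exact: (big_morph _ divisor_degreeD divisor_degree0). Qed.
End DivisorDegree.

(** * Zeros of functions and the distance bound *)

Section MinimumDistance.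
Variables (k : finFieldType) (F : fieldType) (iota : {rmorphism k -> F}).
Hypothesis hF : function_field iota.
Implicit Types (G : divisor iota) (P : place iota).

Lemma RiemannRoch_spaceP G z :
  RiemannRoch_space G z <-> forall P, vge P (- coeff P G) z.
Proof.
rewrite /RiemannRoch_space /vge /=; have [->|z0] := eqVneq z 0.
  by split=> // _; left.
by split=> [[/eqP|[_]//]|H]; [rewrite (negPf z0)|right].
Qed.

(** G + (z) is effective of degree deg G, and its coefficient at a zero of z in s is at least 1. *)
Lemma zeros_le_degree G z (s : seq (place iota)) : uniq s -> z != 0 ->
  RiemannRoch_space G z -> {in s, forall P, coeff P G = 0} ->
  (count (fun P => z \in maxideal P) s)%:Z <= divisor_degree G.
Proof.
move=> us z0 /RiemannRoch_spaceP zG Gs.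
pose S : seq (place iota) :=
  undup (s ++ dom G ++ fset_set (zeros z) ++ fset_set (zeros z^-1)).
have uS : uniq S := undup_uniq _.
have degz : \sum_(P <- S) valuation P z * (place_degree P)%:Z = 0.
  apply: (principal_divisor_degree hF) => // P vP; rewrite mem_undup !mem_cat.
  rewrite !(mem_zeros hF) ?invr_eq0 // -!(valuation_gt0 hF) ?invr_eq0 //.
  by move: vP; rewrite (valuationV hF) oppr_gt0; case: ltgtP; rewrite ?orbT.
rewrite (divisor_degreeE uS); last first.
  by move=> P PG; rewrite mem_undup !mem_cat PG orbT.
have -> : count (fun P => z \in maxideal P) s =
    (\sum_(P <- S) ((P \in s) && (z \in maxideal P)))%N :> nat.
  have pe : perm_eq s [seq P <- S | P \in s].
    apply: uniq_perm => // [|P]; first exact: filter_uniq.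
    by rewrite mem_filter mem_undup mem_cat; case: (P \in s).
  rewrite -sum1_count (perm_big _ pe) big_filter_cond big_mkcond /=.
  by apply: eq_bigr => P _; case: ifP.
rewrite -subr_ge0;
  suff : - (\sum_(P <- S) valuation P z * (place_degree P)%:Z) <=
    \sum_(P <- S) coeff P G * (place_degree P)%:Z
      - (\sum_(P <- S) ((P \in s) && (z \in maxideal P)))%N%:Z.
  by rewrite degz oppr0.
rewrite -sumrN (big_morph Posz PoszD (erefl _)) -sumrB; apply: ler_sum => P _.
have := zG P; rewrite /vge (negPf z0) /= => vP.
have dP := place_degree_gt0 hF P.
have [Ps|Ps] := boolP (P \in s); last by rewrite andFb; nia.
move: vP; rewrite Gs // andTb; have := valuation_gt0 hF P z0.
by case: (z \in maxideal P) => /= ?; nia.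
Qed.

(** Take codewords of z1 and z2 at distance d: every position where they agree is a zero of the
    nonzero function z1 - z2. *)
Lemma minimum_distance_ge (D : seq (place iota)) G d : AG_code_defined D G ->
  is_minimum_distance (AG_code D G) d ->
  (size D)%:Z - divisor_degree G <= d%:Z.
Proof.
move=> [uD Drat DG] [[x [y [[z1 z1G <-] [z2 z2G <-] neq <-]]] _].
pose z := z1 - z2.
have zG : RiemannRoch_space G z.
  apply/RiemannRoch_spaceP => P; apply: (vgeB hF).
    by move/RiemannRoch_spaceP: z1G; apply.
  by move/RiemannRoch_spaceP: z2G; apply.
have z0 : z != 0.
  by rewrite subr_eq0; apply/eqP => z12; apply: neq; rewrite z12.
have residueP P (w : F) : P \in D -> RiemannRoch_space G w ->
    w - iota (residue P w) \in maxideal P.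
  move=> PD /RiemannRoch_spaceP/(_ P); rewrite DG // oppr0 (vge0 hF) => wO.
  rewrite /residue.
  apply: (xgetPex 0 (P := [set c : k | w - iota c \in maxideal P])).
  have Pdeg : place_degree P = 1%N by exact/eqP/(allP Drat).
  have [u [uO ub]] := place_degreeP hF P.
  have i0 : 'I_(place_degree P) by rewrite Pdeg; exact: ord0.
  have all_i i : i = i0.
    by apply: ord_inj; have := ltn_ord i; have := ltn_ord i0; lia.
  have sum1E (c : 'I_(place_degree P) -> F) : \sum_i c i = c i0.
    by rewrite (big_pred1 i0) // => i; rewrite /= (all_i i) eqxx.
  have O1 : 1 \in vring P by rewrite rpred1.
  have [c1 [c1P _]] := ub 1 O1; have [cw [cwP _]] := ub w wO.
  move: c1P cwP; rewrite !sum1E => c1P cwP.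
  have c10 : c1 0 i0 != 0.
    by apply: contraTneq c1P => ->; rewrite rmorph0 mul0r subr0 maxideal1.
  (* The basis element of the residue field need not be 1, so the coordinate of w is divided by that
     of 1. *)
  exists (cw 0 i0 / c1 0 i0) => /=.
  rewrite (_ : w - _ = (w - iota (cw 0 i0) * u i0)
    - iota (cw 0 i0 / c1 0 i0) * (1 - iota (c1 0 i0) * u i0)).
    by rewrite maxidealB // maxidealMl ?vring_const.
  rewrite mulrBr mulr1 mulrA -rmorphM divfK // opprB addrA subrK.
  by [].
have agree P : P \in D -> residue P z1 = residue P z2 -> z \in maxideal P.
  move=> PD eq_r;
    have := maxidealB (residueP P z1 PD z1G) (residueP P z2 PD z2G).
  by rewrite eq_r opprB addrA subrK.
have := zeros_le_degree uD z0 zG DG; rewrite lerBlDr -lerBlDl.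
apply: le_trans; rewrite lerBlDl -PoszD lez_nat /hamming_distance.
rewrite -[X in (X <= _)%N]card_ord -!sum1_card -sum1_count.
rewrite [X in (_ <= X + _)%N]big_mkcond [X in (_ <= _ + X)%N]big_mkcond.
rewrite [X in (_ <= _ + X)%N]big_tnth -big_split /=.
apply: leq_sum => i _; rewrite inE !mxE.
have [eq_r|//] := eqVneq.
by rewrite (agree _ (mem_tnth i (in_tuple D)) eq_r).
Qed.
End MinimumDistance.

(** * The conorm *)

Section Conorm.
Variables (k k' : finFieldType) (F : fieldType) (F' : fieldExtType F).
Variables (iota : {rmorphism k -> F}) (iota' : {rmorphism k' -> F'}).
Hypotheses (hF : function_field iota) (hF' : function_field iota').
Implicit Types (P : place iota) (Q : place iota') (G : divisor iota).

Local Notation above P := (fset_set (places_above P : set (place iota'))).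

Lemma conormE G : conorm iota' G = \sum_(P <- dom G) coeff P G *:
  \sum_(Q <- above P) << (ramification_index Q P)%:Z *g Q >>.
Proof.
apply: eq_bigr => P _; rewrite fsbig_finite //.
exact: finite_places_above.
Qed.

Lemma divisor_degree_conorm G :
  (forall c', exists c, iota' c' = (iota c)%:A) ->
  divisor_degree (conorm iota' G) = (\dim {:F'})%:Z * divisor_degree G.
Proof.
move=> hk; rewrite conormE divisor_degree_sum mulr_sumr; apply: eq_bigr => P _.
rewrite divisor_degreeZ divisor_degree_sum mulrCA -PoszM; congr (_ * _).
rewrite -(fundamental_equality hF hF' hk) (big_morph Posz PoszD (erefl _)).
by apply: eq_bigr => Q _; rewrite divisor_degreeU PoszM.
Qed.

Lemma coeff_conorm0 G P Q : lies_over Q P -> coeff P G = 0 ->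
  coeff Q (conorm iota' G) = 0.
Proof.
move=> over GP; rewrite conormE raddf_sum big_seq big1 // => P1.
rewrite mem_dom => GP1;
  rewrite /= coeffZ raddf_sum big_seq big1 ?mulr0 // => Q1.
rewrite mem_places_above // => /asboolP over1; rewrite /= coeffU.
have [QQ|] := eqVneq Q1 Q; last by rewrite mulr0.
case/eqP: GP1; rewrite -GP; congr coeff; rewrite QQ in over1.
exact: (lies_over_inj hF hF' over1 over).
Qed.

Variables (D : seq (place iota)).
Hypothesis uD : uniq D.

Lemma mem_conorm_places Q :
  (Q \in conorm_places iota' D) = `[< exists2 P, P \in D & lies_over Q P >].
Proof.
rewrite in_fset_set; first by apply/idP/asboolP => [/set_mem|?];
  [|exact/mem_set].
suff -> : [set Q : place iota' | exists2 P, P \in D & lies_over Q P] =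
    \bigcup_(P in [set` D]) places_above P.
  apply: bigcup_finite => [|P _]; first exact: finite_seq.
  exact: finite_places_above.
by apply/seteqP; split=> R [P PD over]; exists P.
Qed.

(** A double count of incident pairs: each place of D' lies over exactly one place of D. *)
Lemma size_conorm_places :
  size (conorm_places iota' D) = (\sum_(P <- D) nb_places_above iota' P)%N.
Proof.
have us : uniq (conorm_places iota' D) by exact: fset_uniq.
rewrite -sum1_size.
transitivity (\sum_(Q <- conorm_places iota' D)
    \sum_(P <- D | `[< lies_over Q P >]) 1)%N.
  rewrite big_seq [RHS]big_seq; apply: eq_bigr => Q.
  rewrite mem_conorm_places => /asboolP[P PD over].
  rewrite (big_rem P PD) /= asboolT // big_seq_cond big1 ?addn0 // => P2.
  rewrite (mem_rem_uniq _ uD) inE => /andP[/andP[/= /eqP neq _]] /asboolP over2.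
  by case: neq; apply: (lies_over_inj hF hF' over2).
rewrite (exchange_big_dep xpredT) //= big_seq [RHS]big_seq;
  apply: eq_bigr => P PD.
rewrite (sum_places_above hF') ?sum1_size // => Q over.
by rewrite mem_conorm_places; apply/asboolP; exists P.
Qed.
End Conorm.

(** * Length and distance of the conorm code *)

Lemma card_extension_constants (k k' : finFieldType) (F : fieldType)
    (F' : fieldExtType F) (iota : {rmorphism k -> F}) (iota' : {rmorphism k' -> F'}) :
  function_field iota' -> (forall c', exists c, iota' c' = (iota c)%:A) ->
  #|k| = #|k'|.
Proof.
move=> hF' hk; apply/eqP; rewrite eqn_leq.
have [f fE] : exists f : k -> k', forall c, (iota c)%:A = iota' (f c).
  by have [f fE] := choice (const_lift iota hF'); exists f.
have [g gE] : exists g : k' -> k, forall c', iota' c' = (iota (g c'))%:A.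
  by have [g gE] := choice hk; exists g.
apply/andP; split; [apply: (leq_card f)|apply: (leq_card g)] => a b eq_ab.
  by apply: (fmorph_inj iota); apply: (fmorph_inj (in_alg F'));
    rewrite /= !fE eq_ab.
by apply: (fmorph_inj iota'); rewrite !gE eq_ab.
Qed.

(** This turns n = r + s into the statement that every P_i splits completely or is totally
    ramified. *)
Lemma count_cover (T : Type) (a b : pred T) (s : seq T) :
  (count a s + count b s)%N = size s -> (forall x, ~~ (a x && b x)) ->
  all (predU a b) s.
Proof.
move=> sab dis; rewrite all_count -sab -count_predUI.
rewrite (eq_count (a1 := predI a b) (a2 := pred0)) ?count_pred0 ?addn0 //.
by move=> x /=; apply/negbTE/dis.
Qed.

Theorem corollary3p2 (q t : nat) (k k' : finFieldType)
    (hk : #|k| = q) (hk' : #|k'| = (q ^ t)%N)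
    (F : fieldType) (iota : {rmorphism k -> F}) (hF : function_field iota)
    (F' : fieldExtType F) (iota' : {rmorphism k' -> F'})
    (hF' : function_field iota')
    (m : nat) (hm : \dim {:F'} = m) (hm2 : (2 <= m)%N)
    (n : nat) (hn : (0 < n)%N) (D : n.-tuple (place iota)) (G : divisor iota)
    (hC : AG_code_defined D G) (hC' : conorm_code_defined iota' D)
    (n' : nat) (hn' : n' = size (conorm_places iota' D))
    (s r : nat) (hs : s = count (splits_completely iota') D)
    (hr : r = count (totally_ramified iota') D)
    (hrs : n = (r + s)%N) :
  (* (a) *)
  ([/\ (n + s <= n')%N, n' = (m * s + r)%N & (m * s + r <= m * n - r)%N]
   /\ ((n + s = n' /\ m * s + r = m * n - r)%N <-> m = 2%N))
  (* (b) *)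
  /\ ((n' = (m * n)%N <-> s = n /\ r = 0%N)
      /\ (n' = (m * n)%N ->
          forall d' : nat, is_minimum_distance (conorm_code iota' D G) d' ->
            m%:R * (n%:R - (divisor_degree G)%:~R / t%:R) <= d'%:R :> rat))
  (* (c) *)
  /\ ((n' = n <-> s = 0%N /\ r = n)
      /\ (n' = n ->
          (forall d' : nat, is_minimum_distance (conorm_code iota' D G) d' ->
             n%:R - m%:R / t%:R * (divisor_degree G)%:~R <= d'%:R :> rat)
          /\ n%:R - m%:R / t%:R * (divisor_degree G)%:~R
             = n%:R - (divisor_degree (conorm iota' G))%:~R :> rat)).
Proof.
have [uD Drat DG] := hC.
have eP P : P \in (D : seq _) -> forall Q : place iota', lies_over Q P ->
    (ramification_index Q P * nb_places_above iota' P)%N = m.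
  by move=> PD Q over; rewrite (hC' P Q PD over) hm.
have nb_split P : splits_completely iota' P -> nb_places_above iota' P = m.
  by move=> /eqP->.
have tr_over P : totally_ramified iota' P -> exists2 Q : place iota',
    lies_over Q P & ramification_index Q P = m.
  by move=> /asboolP[Q]; rewrite hm; exists Q.
(* Membership in D is built in because [count_cover] asks for disjointness everywhere, while the
   condition e(Q|P) m_P = m, which gives m_P = 1 under total ramification, holds on D only. *)
pose spl P := (P \in (D : seq _)) && splits_completely iota' P.
pose tr P := (P \in (D : seq _)) && totally_ramified iota' P.
have nb_tr P : tr P -> nb_places_above iota' P = 1%N.
  move=> /andP[PD /tr_over[Q over eQ]]; have := eP P PD Q over.
  by rewrite eQ => /eqP; rewrite -{2}[m]muln1 eqn_pmul2l ?(ltnW hm2) // => /eqP.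
have {}hs : s = count spl D.
  by rewrite hs; apply: eq_in_count => P PD; rewrite /spl PD.
have {}hr : r = count tr D.
  by rewrite hr; apply: eq_in_count => P PD; rewrite /tr PD.
have covered : all (predU tr spl) D.
  apply: count_cover => [|P]; first by rewrite -hr -hs size_tuple.
  apply/negP => /andP[/nb_tr nb1 /andP[_ /nb_split nbm]].
  by move: hm2; rewrite -nbm nb1.
have nbE P : P \in (D : seq _) -> nb_places_above iota' P = (m * spl P + tr P)%N.
  move=> PD; have := allP covered P PD; rewrite /=.
  have [trP|ntr] /= := boolP (tr P).
    rewrite nb_tr //; case: (boolP (spl P)) => [/andP[_ /nb_split]|].
      by rewrite nb_tr // => m1; move: hm2; rewrite -m1.
    by rewrite muln0.
  by move=> splP; rewrite splP muln1 addn0 nb_split //; case/andP: splP.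
have n'E : n' = (m * s + r)%N.
  rewrite hn' size_conorm_places // big_seq (eq_bigr _ nbE) -big_seq big_split /=.
  rewrite -big_distrr /= hs hr -!sum1_count; congr (_ * _ + _)%N.
    by rewrite [RHS]big_mkcond; apply: eq_bigr => P _; case: (spl P).
  by rewrite [RHS]big_mkcond; apply: eq_bigr => P _; case: (tr P).
(* Total ramification comes with a place above P; complete splitting provides m > 0 of them. *)
have above P : P \in (D : seq _) -> exists Q : place iota', lies_over Q P.
  move=> PD; have /orP[/andP[_ /tr_over[Q over _]]|/andP[_ /nb_split nbm]] :=
    allP covered P PD; first by exists Q.
  have : (0 < #|` fset_set (places_above P : set (place iota'))|)%N.
    by rewrite [#|` _|]nbm ltnW.
  rewrite cardfs_gt0 => /fset0Pn[Q]; rewrite mem_places_above // => /asboolP.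
  by exists Q.
pose P0 := tnth D (Ordinal hn); have P0D : P0 \in (D : seq _) := mem_tnth _ _.
have hconst : forall c', exists c, iota' c' = (iota c)%:A.
  apply: (constants_of_rational hF hF' (allP Drat _ P0D) (above _ P0D)) => Q over.
  by rewrite hm; apply: eP.
(* k and k' now have equal cardinality, so q = q^t with q > 1, and the divisions by t in the bounds
   are divisions by 1. *)
have t1 : t = 1%N.
  have q2 : (1 < q)%N by rewrite -hk card_finRing_gt1.
  have := card_extension_constants hF' hconst; rewrite hk hk' -{1}[q]expn1.
  by move/eqP; rewrite eqn_exp2l // => /eqP.
have degG' : divisor_degree (conorm iota' G) = m%:Z * divisor_degree G.
  by rewrite divisor_degree_conorm // hm.
have codeD' : AG_code_defined (conorm_places iota' D) (conorm iota' G).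
  split; first exact: fset_uniq.
    apply/allP => Q; rewrite mem_conorm_places // => /asboolP[P PD over].
    apply/eqP/(rational_above hF hF' (allP Drat _ PD) (above _ PD)) => //.
    by rewrite hm; exact: eP.
  move=> Q; rewrite mem_conorm_places // => /asboolP[P PD over].
  by apply: (coeff_conorm0 hF hF' over); apply: DG.
have dist d' : is_minimum_distance (conorm_code iota' D G) d' ->
    n'%:Z - m%:Z * divisor_degree G <= d'%:Z.
  by rewrite hn' -degG'; exact: minimum_distance_ge.
have castE (a b : nat) : a%:R - b%:R * (divisor_degree G)%:~R =
    (a%:Z - b%:Z * divisor_degree G)%:~R :> rat.
  by rewrite rmorphB rmorphM.
split; last split.
(* The two gaps in (a) are (m - 2) s and (m - 2) r; both vanish only for m = 2, since r + s = n >
   0. *)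
- split; first by split; [|exact: n'E|]; nia.
  by split=> [[]|m2]; [nia|split; nia].
(* Here m n - n' = (m - 1) r, and in (c) n' - n = (m - 1) s, with m - 1 > 0. *)
- split; first by split=> [|[]]; [split; nia|nia].
  move=> n'mn d' /dist; rewrite t1 divr1 mulrBr -natrM castE -n'mn.
  by rewrite -(ler_int rat).
- split; first by split=> [|[]]; [split; nia|nia].
  move=> n'n; rewrite t1 divr1 degG' castE; split; last by rewrite rmorphB.
  by move=> d' /dist; rewrite n'n -(ler_int rat).
Qed.
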